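(* Let $\Gamma$ be a connected, vertex-transitive, trivalent graph with exactly two ends, and suppose the vertex stabilizers in $\mathrm{Aut}(\Gamma)$ are infinite. Then $\Gamma$ is isomorphic to $\Theta_s$ for some $s\ge0$.
   Context: Let $\Delta_2$ be the digraph with vertex set $\mathbb Z\times\{1,2\}$ whose arcs are all pairs $((i,j),(i+1,j'))$ with $i\in\mathbb Z$, $j,j'\in\{1,2\}$. For a digraph $\Delta$, an $s$-arc is a tuple $(\alpha_0,\dots,\alpha_s)$ with each $(\alpha_i,\alpha_{i+1})$ an arc and $\alpha_{i-1}\ne\alpha_{i+1}$; the $s$-arc digraph $B_s(\Delta)$ has the $s$-arcs of $\Delta$ as vertices and arcs $((\alpha_0,\dots,\alpha_s),(\alpha_1,\dots,\alpha_{s+1}))$ for each $(s+1)$-arc $(\alpha_0,\dots,\alpha_{s+1})$; $B_0(\Delta)=\Delta$. For a digraph $\Delta$ in which every vertex has in- and out-degree 2, let $\Delta_*$ be the digraph with vertices $\alpha_-,\alpha_+$ for each vertex $\alpha$ of $\Delta$ and arcs $(\alpha_-,\alpha_+)$ for every vertex $\alpha$ and $(\alpha_+,\beta_-)$ for every arc $(\alpha,\beta)$ of $\Delta$. Then $\Theta_s$ is the undirected graph underlying $(B_s(\Delta_2))_*$ (two vertices adjacent iff there is an arc between them in either direction). Ends are equivalence classes of rays, two rays being equivalent if some third ray meets both in infinitely many vertices. *)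

(* Defs.v *)
From mathcomp Require Import all_boot all_order all_algebra.
From mathcomp Require Import boolp classical_sets functions cardinality.
From Stdlib Require Import Relation_Operators.

Set Implicit Arguments.
Unset Strict Implicit.
Unset Printing Implicit Defensive.

Import GRing.Theory.
Local Open Scope classical_set_scope.
Local Open Scope card_scope.

Record digraph := Digraph {
  dvertex :> Type;
  darc : dvertex -> dvertex -> Prop
}.

Definition loopless (D : digraph) : Prop := forall x : D, ~ darc x x.

Definition Delta2 : digraph :=
  @Digraph (int * 'I_2)%type (fun x y => y.1 = (x.1 + 1)%R).

Definition is_sarc (D : digraph) (s : nat) (a : s.+1.-tuple D) : Prop :=
  (forall i j : 'I_s.+1, j = i.+1 :> nat -> darc (tnth a i) (tnth a j)) /\
  (forall i j : 'I_s.+1, j = i.+2 :> nat -> tnth a i <> tnth a j).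

Definition sarc (D : digraph) (s : nat) : Type :=
  {a : s.+1.-tuple D | is_sarc a}.

(* For s = 0 the vertices are the 1-tuples of vertices of D, so that
   [sarc_digraph D 0] is D itself up to the identification (x) = x. *)
Definition sarc_digraph (D : digraph) (s : nat) : digraph :=
  @Digraph (sarc D s) (fun a b => exists c : sarc D s.+1,
    forall i : 'I_s.+1,
      tnth (sval a) i = tnth (sval c) (widen_ord (leqnSn s.+1) i) /\
      tnth (sval b) i = tnth (sval c) (lift ord0 i)).

Inductive star_vertex (D : digraph) : Type :=
  | Minus of D
  | Plus of D.

Definition star_arc (D : digraph) (u v : star_vertex D) : Prop :=
  match u, v with
  | Minus x, Plus y => x = y
  | Plus x, Minus y => darc x y
  | _, _ => False
  end.

Definition star (D : digraph) : digraph := Digraph (@star_arc D).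

Lemma star_loopless (D : digraph) : loopless (star D).
Proof. by case=> x; case. Qed.

Record graph := Graph {
  vertex :> Type;
  adj : vertex -> vertex -> Prop;
  adj_sym : forall x y, adj x y -> adj y x;
  adj_irrefl : forall x, ~ adj x x
}.

Section Underlying.
Variables (D : digraph) (llD : loopless D).

Definition underlying_adj (x y : D) : Prop := darc x y \/ darc y x.

Lemma underlying_adj_sym (x y : D) : underlying_adj x y -> underlying_adj y x.
Proof. by case; [right | left]. Qed.

Lemma underlying_adj_irrefl (x : D) : ~ underlying_adj x x.
Proof. by case; apply: llD. Qed.

Definition underlying : graph := Graph underlying_adj_sym underlying_adj_irrefl.

End Underlying.

Definition Theta (s : nat) : graph :=
  underlying (@star_loopless (sarc_digraph Delta2 s)).

Definition is_iso (G H : graph) (f : G -> H) : Prop :=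
  bijective f /\ forall x y : G, adj x y <-> adj (f x) (f y).

Definition isomorphic (G H : graph) : Prop := exists f : G -> H, is_iso f.

Section GraphNotions.
Variable G : graph.

Definition Aut : set (G -> G) := [set f | is_iso f].

Definition stabilizer (x : G) : set (G -> G) := [set f | Aut f /\ f x = x].

Definition vertex_transitive : Prop :=
  forall x y : G, exists2 f, Aut f & f x = y.

Definition connected_graph : Prop :=
  forall x y : G, clos_refl_trans G (@adj G) x y.

Definition trivalent : Prop := forall x : G, [set y | adj x y] #= `I_3.

Definition is_ray (r : nat -> G) : Prop :=
  injective r /\ forall n, adj (r n) (r n.+1).

Definition ray_equiv (r r' : nat -> G) : Prop :=
  exists t, [/\ is_ray t, infinite_set (range t `&` range r) &
                infinite_set (range t `&` range r')].

Definition end_of (r : nat -> G) : set (nat -> G) :=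
  [set r' | is_ray r' /\ ray_equiv r r'].

Definition ends : set (set (nat -> G)) := end_of @` [set r | is_ray r].

End GraphNotions.

Arguments Aut : clear implicits.
Arguments ends : clear implicits.

(* Main.v *)
(* Fix a set X of vertices with finite boundary separating the two ends.  The
   automorphisms g for which g X and X differ by finitely many vertices, with as
   many gained as lost, form a normal subgroup K of Aut G; its orbits are finite,
   since g X and X are nested as soon as g moves some vertex far away, and it
   contains a subgroup of index at most 2 of each vertex stabilizer.

   K being normal with finite orbits and nontrivial stabilizers, exactly two of
   the three neighbours of each vertex share a K-orbit.  The edges to the third
   neighbour form a perfect matching, and G / K is a two-way infinite path
   alternating between matching and non-matching edges.  Contracting the matching
   yields a digraph D with finite levels indexed by the integers, with in- and
   out-degree 2 and with G = D_*.

   If two in-neighbours of a vertex of D have distinct out-neighbourhoods, an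
   automorphism is determined by its restriction to one level, contradicting the
   infinity of K.  Hence the non-matching edges form 4-cycles, and either D is
   Delta_2 or D is the line digraph of the smaller digraph whose vertices are
   these 4-cycles; induction on the size of a level gives D = B_s(Delta_2). *)

Require Import Defs.
From mathcomp Require Import all_boot all_order all_algebra finmap zify.
From mathcomp Require Import boolp classical_sets functions cardinality fsbigop.

Set Implicit Arguments.
Unset Strict Implicit.
Unset Printing Implicit Defensive.

Import GRing.Theory Order.TTheory.
Local Open Scope classical_set_scope.
Local Open Scope card_scope.

(** * Bijections, induction on the integers, and finiteness *)

Lemma inj_surj_bijective (T U : Type) (f : T -> U) :
  injective f -> (forall y, exists x, f x = y) -> bijective f.
Proof.
move=> finj /choice[g gE]; exists g => // x.
by apply: finj; rewrite gE.
Qed.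

Lemma int_updown_ind (P : int -> Prop) :
  P 0%R -> (forall i, P i -> P (i + 1)%R) -> (forall i, P i -> P (i - 1)%R) ->
  forall i, P i.
Proof.
move=> P0 up down; elim/int_ind => [//|n /up|n /down]; congr P; lia.
Qed.

Lemma finite_set_inj (T U : Type) (A : set T) (B : set U) (f : T -> U) :
  {in A &, injective f} -> (forall x, A x -> B (f x)) ->
  finite_set B -> finite_set A.
Proof.
move=> finj fAB finB; rewrite -(eq_finite_set (inj_card_eq finj)).
by apply: sub_finite_set finB => _ [x Ax <-]; exact: fAB.
Qed.

Lemma infinite_set_seq (T : Type) (A : set T) (u : nat -> T) :
  injective u -> (forall n, A (u n)) -> infinite_set A.
Proof.
move=> uinj uA Afin; apply: infinite_nat.
by apply: (@finite_set_inj _ _ _ A u) => // x y _ _; exact: uinj.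
Qed.

(** * Arcs of the digraphs B_s(Delta_2) *)

Section SarcDelta2.

Implicit Types s : nat.

Lemma sarc_eq s (a b : sarc Delta2 s) :
  (forall i, tnth (sval a) i = tnth (sval b) i) -> a = b.
Proof.
by case: a b => [a pa] [b pb] /= /eq_from_tnth ab; apply: eq_exist.
Qed.

(** The condition on vertices two steps apart is automatic in [Delta2], where their levels differ by
    2. *)
Lemma is_sarcP s (a : s.+1.-tuple Delta2) :
  (forall i j : 'I_s.+1, j = i.+1 :> nat ->
     (tnth a j).1 = ((tnth a i).1 + 1)%R) -> is_sarc a.
Proof.
move=> arc; split=> // i j ji.
have lti : i.+1 < s.+1 by rewrite (leq_trans _ (ltn_ord j))// ji.
have /= := arc i (Ordinal lti) erefl; have := arc (Ordinal lti) j ji.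
move=> e2 e1 /(congr1 fst) /=; rewrite e2 e1.
by move: (tnth a i).1 => x; lia.
Qed.

Fact sarc_init_subproof s (c : sarc Delta2 s.+1) :
  is_sarc [tuple tnth (sval c) (widen_ord (leqnSn s.+1) i) | i < s.+1].
Proof.
apply: is_sarcP => i j ij; rewrite !tnth_mktuple.
by have [+ _] := svalP c; apply.
Qed.
Definition sarc_init s c : sarc Delta2 s := exist _ _ (@sarc_init_subproof s c).

Fact sarc_tail_subproof s (c : sarc Delta2 s.+1) :
  is_sarc [tuple tnth (sval c) (lift ord0 i) | i < s.+1].
Proof.
apply: is_sarcP => i j ij; rewrite !tnth_mktuple.
by have [+ _] := svalP c; apply; rewrite /= /bump /= !add1n ij.
Qed.
Definition sarc_tail s c : sarc Delta2 s := exist _ _ (@sarc_tail_subproof s c).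

Lemma sarc_arcP s (a b : sarc_digraph Delta2 s) :
  darc a b <-> exists c, sarc_init c = a /\ sarc_tail c = b.
Proof.
split=> -[c abc]; exists c.
  by split; apply: sarc_eq => i; rewrite tnth_mktuple; have [] := abc i.
by case: abc => <- <- i; rewrite !tnth_mktuple.
Qed.

Lemma sarc_init_tail_inj s (c d : sarc Delta2 s.+1) :
  sarc_init c = sarc_init d -> sarc_tail c = sarc_tail d -> c = d.
Proof.
move=> /(congr1 sval) eqi /(congr1 sval) eqt; apply: sarc_eq => i.
have [->|[j ->]] : i = widen_ord (leqnSn s.+1) ord0 \/ exists j, i = lift ord0 j.
- case: (unliftP ord0 i) => [j ->|->]; first by right; exists j.
  by left; apply: val_inj.
- by have := congr1 (fun t => tnth t ord0) eqi; rewrite !tnth_mktuple.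
- by have := congr1 (fun t => tnth t j) eqt; rewrite !tnth_mktuple.
Qed.

(** This exhibits B_{s+1}(Delta_2) as the line digraph of B_s(Delta_2). Backwards, the first vertex
    of [c] put before [d] gives the required (s+2)-arc, since [is_sarcP] asks only for consecutive
    levels. *)
Lemma sarc_arcS s (c d : sarc_digraph Delta2 s.+1) :
  darc c d <-> sarc_tail c = sarc_init d.
Proof.
split=> [/sarc_arcP[e [<- <-]]|cd].
  apply: sarc_eq => i; rewrite !tnth_mktuple; congr (tnth _ _).
  exact: val_inj.
pose t := [tuple of tnth (sval c) ord0 :: sval d].
have tcd (i : 'I_s.+2) : tnth t (widen_ord (leqnSn s.+2) i) = tnth (sval c) i.
  case: (unliftP ord0 i) => [j ->|->]; last by rewrite (tnth_nth (tnth (sval c) ord0)).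
  have /(congr1 (fun t => tnth (sval t) j)) := cd.
  rewrite !tnth_mktuple => ->.
  have -> : widen_ord (leqnSn s.+2) (lift ord0 j) =
            lift ord0 (widen_ord (leqnSn s.+1) j) by apply: val_inj.
  by rewrite tnthS.
have tarc : is_sarc t.
  apply: is_sarcP => i j ij.
  case: (unliftP ord0 j) ij => [k ->|->] //; rewrite /= /bump /= add1n => -[ki].
  rewrite tnthS; case: (unliftP ord0 i) ki => [l ->|->] /=.
    rewrite /bump /= add1n tnthS => kl.
    by have [/(_ l k kl)] := svalP d.
  move=> k0; have -> : k = ord0 by apply: val_inj.
  rewrite tnth0.
  have := tcd (lift ord0 ord0).
  have -> : widen_ord (leqnSn s.+2) (lift ord0 ord0) = lift ord0 ord0 :> 'I_s.+3.
    exact: val_inj.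
  rewrite tnthS => ->.
  by have [/(_ ord0 (lift ord0 ord0) erefl)] := svalP c.
apply/sarc_arcP; exists (exist _ t tarc); split; apply: sarc_eq => i.
  by rewrite tnth_mktuple /= tcd.
by rewrite tnth_mktuple tnthS.
Qed.

Definition sarc1 (x : Delta2) : sarc Delta2 0.
Proof.
exists [tuple x]; apply: is_sarcP => i j.
by rewrite (ord1 i) (ord1 j).
Defined.

Lemma sarc1_surj (a : sarc Delta2 0) : exists x, sarc1 x = a.
Proof.
exists (tnth (sval a) ord0); apply: sarc_eq => i.
by rewrite (ord1 i) (tnth_nth (tnth (sval a) ord0)).
Qed.

Lemma sarc1_inj : injective sarc1.
Proof. by move=> x y /(congr1 sval) /= [] ->. Qed.

Lemma sarc1_arc x y :
  darc (sarc1 x : sarc_digraph Delta2 0) (sarc1 y) <-> y.1 = (x.1 + 1)%R.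
Proof.
split.
  move=> /sarc_arcP[c [/(congr1 (fun a => tnth (sval a) ord0)) +
                       /(congr1 (fun a => tnth (sval a) ord0))]].
  rewrite !tnth_mktuple /= !(tnth_nth x) /= => cx cy.
  have [/(_ ord0 (lift ord0 ord0) erefl)] := svalP c.
  by rewrite /= !(tnth_nth x) /= cx cy.
move=> xy.
have c : is_sarc [tuple x; y].
  apply: is_sarcP => i j; rewrite !(tnth_nth x) /=.
  by case: i => [[|[|i]] ilt] //=; case: j => [[|[|j]] jlt].
apply/sarc_arcP; exists (exist _ _ c); split; apply: sarc_eq => i;
  by rewrite (ord1 i) tnth_mktuple !(tnth_nth x).
Qed.

End SarcDelta2.

(** * Levelled digraphs with infinitely many automorphisms *)

Definition dig_aut (D : Type) (a : D -> D -> Prop) (g : D -> D) : Prop :=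
  bijective g /\ forall x y, a x y <-> a (g x) (g y).

Lemma dig_aut_can (D : Type) (a : D -> D -> Prop) g g' :
  dig_aut a g -> cancel g g' -> cancel g' g -> dig_aut a g'.
Proof.
move=> [_ ga] gK g'K; split; first by exists g.
by move=> x y; rewrite -{1}[x]g'K -{1}[y]g'K; exact: iff_sym (ga _ _).
Qed.

Lemma dig_aut_comp (D : Type) (a : D -> D -> Prop) k l :
  dig_aut a k -> dig_aut a l -> dig_aut a (k \o l).
Proof.
move=> [kb ka] [lb la]; split; first exact: bij_comp.
by move=> x y; exact: iff_trans (la x y) (ka _ _).
Qed.

(** These properties survive contraction, which lets an induction run on them. [good_conn] is weak
    connectedness in the form of an induction principle; [good_fin] supplies the measure. *)
Record good_digraph (D : Type) (a : D -> D -> Prop) (h : D -> int) : Prop :=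
  GoodDigraph {
    good_inh : inhabited D;
    good_height : forall x y, a x y -> h y = (h x + 1)%R;
    good_out : forall x, exists y z,
      y <> z /\ forall w, a x w <-> w = y \/ w = z;
    good_in : forall x, exists y z,
      y <> z /\ forall w, a w x <-> w = y \/ w = z;
    good_trans : forall x y, exists2 g, dig_aut a g & g x = y;
    good_conn : forall P : D -> Prop, (exists x, P x) ->
      (forall x y, a x y -> (P x <-> P y)) -> forall y, P y;
    good_inf : infinite_set [set g | dig_aut a g /\ forall x, h (g x) = h x];
    good_fin : finite_set [set x | h x = 0%R]
  }.

Section GoodDigraph.
Variables (D : choiceType) (a : D -> D -> Prop) (h : D -> int).
Hypothesis gD : good_digraph a h.

Lemma good_out_other x y : a x y ->
  exists z, [/\ z <> y, a x z & forall w, a x w -> w = y \/ w = z].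
Proof.
have [u [v [uv xE]]] := good_out gD x.
move=> /xE[->|->].
- exists v; split; [by move=> vu; apply: uv | by apply/xE; right|].
  by move=> w /xE.
- exists u; split; [by [] | by apply/xE; left|].
  by move=> w /xE[->|->]; [right|left].
Qed.

Lemma good_in_other x y : a y x ->
  exists z, [/\ z <> y, a z x & forall w, a w x -> w = y \/ w = z].
Proof.
have [u [v [uv xE]]] := good_in gD x.
move=> /xE[->|->].
- exists v; split; [by move=> vu; apply: uv | by apply/xE; right|].
  by move=> w /xE.
- exists u; split; [by [] | by apply/xE; left|].
  by move=> w /xE[->|->]; [right|left].
Qed.

Lemma good_in_two x y z w : a x z -> a y z -> a w z -> x <> y ->
  w = x \/ w = y.
Proof.
move=> xz yz wz xy; have [u [_ _ uE]] := good_in_other xz.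
have [yx|->] := uE _ yz; last exact: uE.
by case: xy; rewrite yx.
Qed.

Lemma good_out_two x y z w : a x y -> a x z -> a x w -> y <> z ->
  w = y \/ w = z.
Proof.
move=> xy xz xw yz; have [u [_ _ uE]] := good_out_other xy.
have [zy|->] := uE _ xz; last exact: uE.
by case: yz; rewrite zy.
Qed.

Lemma good_succ x : exists y, a x y.
Proof. by have [y [z [_ E]]] := good_out gD x; exists y; apply/E; left. Qed.

Lemma good_pred x : exists y, a y x.
Proof. by have [y [z [_ E]]] := good_in gD x; exists y; apply/E; left. Qed.

Lemma good_level_nonempty i : exists x, h x = i.
Proof.
have [x0] := good_inh gD.
have hu j : exists x, h x = (j + h x0)%R.
  elim/int_updown_ind: j => [|j [x IH]|j [x IH]]; first by exists x0; lia.
    by have [y /(good_height gD) hy] := good_succ x; exists y; lia.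
  by have [y /(good_height gD) hy] := good_pred x; exists y; lia.
by have [x hx] := hu (i - h x0)%R; exists x; rewrite hx; lia.
Qed.

Definition same_out x y := forall w, a x w <-> a y w.

Lemma same_out_refl x : same_out x x. Proof. by []. Qed.

Lemma same_out_sym x y : same_out x y -> same_out y x.
Proof. by move=> xy w; split=> /xy. Qed.

Lemma same_out_trans y x z : same_out x y -> same_out y z -> same_out x z.
Proof. by move=> xy yz w; split=> [/xy/yz|/yz/xy]. Qed.

Lemma dig_aut_same_out g x y : dig_aut a g ->
  same_out (g x) (g y) <-> same_out x y.
Proof.
move=> [[g' gK g'K] ga]; split=> xy w.
  exact: iff_trans (ga x w) (iff_trans (xy (g w)) (iff_sym (ga y w))).
rewrite -[w]g'K.
exact: iff_trans (iff_sym (ga x _)) (iff_trans (xy (g' w)) (ga y _)).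
Qed.

Lemma dig_aut_inj g : dig_aut a g -> injective g.
Proof. by case=> /bij_inj. Qed.

Lemma same_out_height x y : same_out x y -> h x = h y.
Proof.
have [z xz] := good_succ x; move=> /(_ z)[+ _] => /(_ xz) yz.
by have := good_height gD xz; rewrite (good_height gD yz); lia.
Qed.

(* If some two in-neighbours of a vertex have distinct out-neighbourhoods, then
   by transitivity no two vertices have two common out-neighbours, so an
   automorphism is determined by its values on a single level. *)
Section Thick.
Hypothesis no_K22 : forall x y z w,
  x <> y -> a x z -> a y z -> a x w -> a y w -> w = z.

Lemma thick_rigid g1 g2 :
  dig_aut a g1 -> dig_aut a g2 ->
  (forall x, h x = 0%R -> g1 x = g2 x) -> g1 = g2.
Proof.
move=> a1 a2 g0; have [_ m1] := a1; have [_ m2] := a2.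
pose agree i := forall x, h x = i -> g1 x = g2 x.
have up i : agree i -> agree (i + 1)%R.
  move=> gi z hz; have [x xz] := good_pred z.
  have [y [yx yz _]] := good_in_other xz.
  have /gi ex : h x = i by have := good_height gD xz; rewrite hz; lia.
  have /gi ey : h y = i by have := good_height gD yz; rewrite hz; lia.
  apply: (@no_K22 (g1 x) (g1 y)); try exact: (m1 _ _).1.
  - by move=> /(dig_aut_inj a1) xy; apply: yx.
  - by rewrite ex; exact: (m2 _ _).1.
  - by rewrite ey; exact: (m2 _ _).1.
have down i : agree i -> agree (i - 1)%R.
  move=> gi x hx; have [z xz] := good_succ x.
  have [w [wz xw _]] := good_out_other xz.
  have /gi ez : h z = i by rewrite (good_height gD xz) hx; lia.
  have /gi ew : h w = i by rewrite (good_height gD xw) hx; lia.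
  (* Distinct [g1 x] and [g2 x] would have the two common out-neighbours [g1 z] and [g1 w]. *)
  apply: contrapT => g12; apply: wz; apply: (dig_aut_inj a1).
  apply: (no_K22 g12); try exact: (m1 _ _).1.
  - by rewrite ez; exact: (m2 _ _).1.
  - by rewrite ew; exact: (m2 _ _).1.
have all := int_updown_ind g0 up down.
by apply/funext => x; apply: (all (h x)).
Qed.

(** A height-preserving automorphism is determined by its action on the finite level 0, so only
    finitely many exist, against [good_inf]. *)
Lemma thick_absurd : False.
Proof.
apply: (good_inf gD).
have /finite_seqP[s sE] := good_fin gD.
have [x0] := good_inh gD.
pose n := (size s).
(* [index] returns [n] for an element outside [s], hence the codomain ['I_n.+1]. *)
pose F (g : D -> D) : {ffun 'I_n -> 'I_n.+1} :=
  [ffun i => inord (index (g (nth x0 s (val i))) s)].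
apply: (@finite_set_inj _ _ _ setT F) => //.
move=> g1 g2; rewrite !inE /= => -[a1 h1] [a2 h2] F12.
apply: thick_rigid => // x hx.
have ins y : h y = 0%R -> y \in s by move=> hy; have : [set` s] y by rewrite -sE.
have lt : index x s < n by rewrite index_mem ins.
have := congr1 (fun f : {ffun _ -> _} => val (f (Ordinal lt))) F12.
rewrite !ffunE /= nth_index ?ins// !inordK ?ltnS ?index_size// => eqi.
have in1 : g1 x \in s by rewrite ins ?h1.
have in2 : g2 x \in s by rewrite ins ?h2.
by rewrite -(nth_index x0 in1) eqi nth_index.
Qed.

End Thick.

(** Otherwise transitivity makes the two in-neighbours of every vertex differ in their
    out-neighbourhoods. But distinct vertices with two common out-neighbours have equal
    out-neighbourhoods, so there are none, and [thick_absurd] applies. *)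
Lemma good_thin x y z : a x z -> a y z -> same_out x y.
Proof.
move=> xz yz; apply: contrapT => nxy; apply: thick_absurd.
have thick u v w : u <> v -> a u w -> a v w -> ~ same_out u v.
  move=> uv uw vw suv; have [g ag gz] := good_trans gD z w.
  have gxz : a (g x) w by rewrite -gz; apply: (ag.2 _ _).1.
  have gyz : a (g y) w by rewrite -gz; apply: (ag.2 _ _).1.
  apply: nxy; apply: (dig_aut_same_out _ _ ag).1.
  have [->|->] := good_in_two uw vw gxz uv;
    have [->|->] := good_in_two uw vw gyz uv => //; exact: same_out_sym.
move=> u v w t uv uw vw ut vt; apply: contrapT => tw.
apply: (thick _ _ _ uv uw vw) => r.
by split=> ur; [have [->|->] := good_out_two ut uw ur tw
              | have [->|->] := good_out_two vt vw ur tw].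
Qed.

(** By [good_thin], the class of [x] consists of the two in-neighbours of any out-neighbour of
    [x]. *)
Lemma same_out_two x : exists y,
  [/\ y <> x, same_out x y & forall z, same_out x z -> z = x \/ z = y].
Proof.
have [w xw] := good_succ x; have [y [yx yw yE]] := good_in_other xw.
exists y; split=> // [|z xz]; first exact: good_thin xw yw.
by apply: yE; apply/xz.
Qed.

Definition rep x := choose (fun y => `[< same_out x y >]) x.

Lemma rep_same x : same_out x (rep x).
Proof.
by apply/asboolP; apply: (@chooseP _ (fun y => `[< same_out x y >])); apply/asboolP.
Qed.

Lemma rep_eq x y : same_out x y -> rep x = rep y.
Proof.
move=> xy; rewrite /rep.
have /eq_choose -> : (fun z => `[< same_out x z >]) =1 (fun z => `[< same_out y z >]).
  move=> z; apply/asboolP/asboolP; first exact/same_out_trans/same_out_sym.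
  exact: same_out_trans.
by apply: choose_id; apply/asboolP => //; exact: same_out_sym.
Qed.

Lemma rep_eqP x y : rep x = rep y <-> same_out x y.
Proof.
split=> [xy|]; last exact: rep_eq.
apply: (same_out_trans (rep_same x)); rewrite xy.
by apply: same_out_sym; exact: rep_same.
Qed.

Lemma rep_id x : rep (rep x) = rep x.
Proof. by apply/rep_eqP/same_out_sym; exact: rep_same. Qed.

Lemma rep_arc x y : a x y <-> a (rep x) y.
Proof. exact: rep_same. Qed.

Lemma same_out_double x y z : same_out x y -> same_out x z ->
  y <> z -> forall w, same_out x w -> w = y \/ w = z.
Proof.
have [u [ux xu uE]] := same_out_two x.
move=> /uE[->|->] /uE[->|->] yz w /uE[->|->]; by [case: yz|left|right].
Qed.

End GoodDigraph.

(** * The case where both out-neighbours of a vertex have the same out-neighbourhood *)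

Definition dig_iso (D D' : Type) (a : D -> D -> Prop) (a' : D' -> D' -> Prop) :=
  exists f : D -> D', bijective f /\ forall x y, a x y <-> a' (f x) (f y).

Section BiPath.
Variables (D : Type) (a : D -> D -> Prop).
Hypotheses (succ : forall x, exists y, a x y) (pred : forall x, exists y, a y x).

Lemma two_way_path x0 :
  exists u : int -> D, u 0%R = x0 /\ forall i, a (u i) (u (i + 1)%R).
Proof.
have [f fE] := choice succ; have [g gE] := choice pred.
(* [Negz n] is -(n+1), hence [n.+1] backward steps. *)
exists (fun i => match i with Posz n => iter n f x0 | Negz n => iter n.+1 g x0 end).
split=> // -[n|n]; first by rewrite -[1%R]/(Posz 1) -PoszD addn1; exact: fE.
case: n => [|n]; first exact: gE.
have -> : (Negz n.+1 + 1 = Negz n)%R by lia.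
exact: gE.
Qed.
End BiPath.

Section Double.
Variables (D : choiceType) (a : D -> D -> Prop) (h : D -> int).
Hypothesis gD : good_digraph a h.
Hypothesis double : forall x y z, a x y -> a x z -> same_out a y z.

(** A two-way path [u] meets every level once; connectedness shows each vertex to be equivalent to
    the vertex of [u] on its level. *)
Lemma double_level x y : h x = h y -> same_out a x y.
Proof.
have [x0] := good_inh gD.
have [u [u0 uE]] := two_way_path (good_succ gD) (good_pred gD) x0.
have key z : same_out a z (u (h z - h x0)%R).
  move: z; apply: (good_conn gD); first by exists x0; rewrite subrr u0.
  move=> z w zw; have hzw := good_height gD zw; split=> [zu|wu].
    apply: (double zw); apply/zu.
    by have := uE (h z - h x0)%R; congr (a _ (u _)); lia.
  have uz := uE (h z - h x0)%R.
  move: uz; have -> : (h z - h x0 + 1 = h w - h x0)%R by lia.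
  set v := u (h w - h x0)%R in wu *; set t := u _ => tv.
  (* The pairs [v], [v'] and [w], [w'] both fill the same two-element class, so [t] and [z] have the
     same out-neighbours. *)
  have [v' [v'v tv' tE]] := good_out_other gD tv.
  have [w' [w'w zw' zE]] := good_out_other gD zw.
  have vw : same_out a v w by exact: same_out_sym.
  have vv' := double tv tv'.
  have vw' := same_out_trans vw (double zw zw').
  have nv : v <> v' by move=> /esym.
  have nw : w <> w' by move=> /esym.
  move=> r; split=> [/zE[]->|/tE[]->].
  - by have [->|->] := same_out_double gD (same_out_refl _ v) vv' nv vw.
  - by have [->|->] := same_out_double gD (same_out_refl _ v) vv' nv vw'.
  - by have [->|->] := same_out_double gD vw vw' nw (same_out_refl _ v).
  - by have [->|->] := same_out_double gD vw vw' nw vv'.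
by move=> hxy; apply: (same_out_trans (key x)); rewrite hxy; exact: same_out_sym (key y).
Qed.

(** A level is a single [same_out] class with two members; [bit] tells the representative from the
    other one. *)
Lemma double_iso : dig_iso a (@darc (sarc_digraph Delta2 0)).
Proof.
pose bit x : 'I_2 := inord (x == rep a x).
exists (fun x => sarc1 (h x, bit x)); split; last first.
  move=> x y; split; first by move=> xy; apply: (sarc1_arc _ _).2; rewrite /= (good_height gD xy).
  move=> /(sarc1_arc _ _).1 /= hy; have [z xz] := good_succ gD x.
  have zy : same_out a z y by apply: double_level; rewrite hy (good_height gD xz).
  have [z' [z'z xz' _]] := good_out_other gD xz.
  have nz : z <> z' by move=> /esym.
  by have [->|->] := same_out_double gD (same_out_refl _ z) (double xz xz') nz zy.
have bitE x y : bit x = bit y -> (x == rep a x) = (y == rep a y).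
  move=> /(congr1 val); rewrite /= !inordK; first by do 2 case: (_ == _).
    by case: (_ == _).
  by case: (_ == _).
apply: inj_surj_bijective.
  move=> x y /sarc1_inj [hxy /bitE].
  have xy := double_level hxy; rewrite -(rep_eq xy).
  case: eqP => [xr /esym/eqP -> //|xr /esym/eqP yr].
  have nx : rep a x <> x by move=> /esym.
  by have [|->] := same_out_double gD (rep_same a x) (same_out_refl _ x) nx xy.
move=> c; have [[i b] <-] := sarc1_surj c.
have [x hx] := good_level_nonempty gD i.
have [y [yr ry _]] := same_out_two gD (rep a x).
have hr : h (rep a x) = i by rewrite -(same_out_height gD (rep_same a x)).
have hy : h y = i by rewrite -(same_out_height gD ry).
have : b = 0%R \/ b = 1%R by case: b => [[|[|b]] ?] //; [left|right]; apply: val_inj.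
case=> ->.
  exists y; rewrite hy /bit -(rep_eq ry) rep_id; congr (sarc1 (_, _)).
  by apply: val_inj; rewrite /= inordK; case: eqP.
exists (rep a x); rewrite hr /bit rep_id eqxx; congr (sarc1 (_, _)).
by apply: val_inj; rewrite /= inordK.
Qed.

End Double.

(* A digraph whose alternating cycles all have length 4 and without parallel
   arcs between them is the line digraph of the digraph having these cycles as
   vertices; a cycle is represented here by one of its two tails. *)
Section Contract.
Variables (D : choiceType) (a : D -> D -> Prop) (h : D -> int).
Hypothesis gD : good_digraph a h.
Hypothesis simple : forall x y z, a x y -> a x z -> same_out a y z -> y = z.

Definition contraction := {x : D | rep a x == x}.
Local Notation D' := contraction.

Fact contract_subproof x : rep a (rep a x) == rep a x.
Proof. by rewrite rep_id. Qed.
Definition contract x : D' :=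
  exist (fun y => rep a y == y) (rep a x) (contract_subproof x).

Lemma contractE (u : D') : contract (val u) = u.
Proof. by apply: val_inj => /=; apply/eqP; exact: (svalP u). Qed.

Lemma contract_eqP x y : contract x = contract y <-> same_out a x y.
Proof.
split=> [/(congr1 val) /= /rep_eqP //|xy].
by apply: val_inj => /=; apply/rep_eqP.
Qed.

Definition contract_arc (u w : D') := exists x, contract x = w /\ a (val u) x.
Local Notation a' := contract_arc.

Lemma contract_arcW x y : a x y -> a' (contract x) (contract y).
Proof. by move=> xy; exists y; split=> //; exact: (rep_arc a x y).1. Qed.

Definition contract_map (g : D -> D) (u : D') : D' := contract (g (val u)).

Lemma contract_mapE g x : dig_aut a g ->
  contract_map g (contract x) = contract (g x).
Proof.
move=> ag; apply/contract_eqP; apply: (dig_aut_same_out _ _ ag).2.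
by apply: same_out_sym; exact: rep_same.
Qed.

Lemma contract_map_aut g : dig_aut a g -> dig_aut a' (contract_map g).
Proof.
move=> ag; have [[g' gK g'K] _] := ag; have ag' := dig_aut_can ag gK g'K.
have mono k u w : dig_aut a k -> a' u w -> a' (contract_map k u) (contract_map k w).
  move=> ak [x [<- ux]]; rewrite contract_mapE//.
  by rewrite -{1}[u]contractE contract_mapE//; apply/contract_arcW/(ak.2 _ _).1.
have can k k' : dig_aut a k -> dig_aut a k' -> cancel k k' ->
    cancel (contract_map k) (contract_map k').
  by move=> ak ak' kK u; rewrite /contract_map -/(contract_map k' _) contract_mapE// kK contractE.
split; first by exists (contract_map g'); exact: can.
move=> u w; split; first exact: mono.
by move=> /(mono _ _ _ ag'); rewrite !can.
Qed.

(** By [simple], distinct out-neighbours of a vertex lie in distinct classes, so out-degrees stay 2;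
    in-degrees do too, because the two members of a class have no common in-neighbour. The same
    hypothesis recovers a height-preserving automorphism from its contraction, so infinitely many
    remain. *)
Lemma contract_good : good_digraph a' (fun u => h (val u)).
Proof.
split.
- by have [x] := good_inh gD; constructor; exact: (contract x).
- move=> u w [x [<- /(good_height gD) <-]] /=.
  by rewrite -(same_out_height gD (rep_same a x)).
- move=> u; have [y [z [yz uE]]] := good_out gD (val u).
  exists (contract y), (contract z); split.
    move=> /contract_eqP yzs; apply: yz; apply: (@simple (val u)) => //; apply/uE; tauto.
  move=> w; split.
    by move=> [x [<- /uE[]->]]; tauto.
  by case=> ->; [exists y|exists z]; split=> //; apply/uE; tauto.
- move=> w; have [w2 [w2w ww2 wE]] := same_out_two gD (val w).
  have [y yw] := good_pred gD (val w); have [y2 yw2] := good_pred gD w2.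
  exists (contract y), (contract y2); split.
    move=> /contract_eqP /(_ w2)[_ /(_ yw2) yw2'].
    by apply: w2w; apply: simple yw2' yw _; exact: same_out_sym.
  move=> u; split.
    move=> [x [xw ux]]; have : same_out a (val w) x.
      by apply/contract_eqP; rewrite xw contractE.
    move=> /wE[]xE; rewrite xE in ux; [left|right]; rewrite -[u]contractE; apply/contract_eqP.
      exact: good_thin gD _ _ _ ux yw.
    exact: good_thin gD _ _ _ ux yw2.
  case=> ->; first by exists (val w); rewrite contractE; split=> //=; exact: (rep_arc a _ _).1.
  exists w2; split; last exact: (rep_arc a _ _).1.
  by rewrite -[w]contractE; apply/contract_eqP; exact: same_out_sym.
- move=> u w; have [g ag gu] := good_trans gD (val u) (val w).
  by exists (contract_map g); [exact: contract_map_aut|rewrite /contract_map gu contractE].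
- move=> P [u Pu] PE w; rewrite -[w]contractE.
  apply: (good_conn gD (P := fun x => P (contract x))).
    by exists (val u); rewrite contractE.
  by move=> x y /contract_arcW /PE.
- move=> fin; apply: (good_inf gD).
  apply: (@finite_set_inj _ _ _ _ contract_map) fin.
    move=> g1 g2; rewrite !inE /= => -[a1 h1] [a2 h2] g12.
    have s12 x : same_out a (g1 x) (g2 x).
      by apply/contract_eqP; rewrite -!contract_mapE// g12.
    apply/funext => x; have [y yx] := good_pred gD x.
    apply: (simple (x := g1 y)) => //; first exact: (a1.2 _ _).1.
    by apply/(s12 y); exact: (a2.2 _ _).1.
  move=> g [ag hg]; split; first exact: contract_map_aut.
  by move=> u; rewrite /= -(same_out_height gD (rep_same a _)) hg.
- apply: (@finite_set_inj _ _ _ _ val) (good_fin gD) => //.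
  by move=> u w _ _; exact: val_inj.
Qed.

(** A vertex [x] becomes the arc from the class of its in-neighbours to its own class. Through [F]
    this is an arc of B_s, that is, an (s+1)-arc of [Delta2]. *)
Lemma contract_iso s : dig_iso a' (@darc (sarc_digraph Delta2 s)) ->
  dig_iso a (@darc (sarc_digraph Delta2 s.+1)).
Proof.
move=> [F [Fbij FE]]; have [F' FK F'K] := Fbij.
have [prd prdE] := choice (good_pred gD).
have : forall x, exists c, sarc_init c = F (contract (prd x)) /\ sarc_tail c = F (contract x).
  by move=> x; apply/sarc_arcP/FE; exact: contract_arcW.
move=> /choice[f fE]; exists f.
have arc_prd x y : a x y <-> contract x = contract (prd y).
  split; first by move=> xy; apply/contract_eqP; exact: good_thin gD _ _ _ xy (prdE y).
  by move=> /contract_eqP xy; apply/xy.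
split; last first.
  move=> x y; apply: (iff_trans (arc_prd x y)); apply: iff_trans (iff_sym (sarc_arcS _ _)).
  rewrite (fE x).2 (fE y).1; split=> [-> //|]; exact: (can_inj FK).
apply: inj_surj_bijective.
  move=> x y fxy; have := fE x; rewrite fxy => -[].
  rewrite (fE y).1 (fE y).2 => /(can_inj FK) /contract_eqP xyp /(can_inj FK) /contract_eqP xy.
  by apply: (simple (x := prd x)) => //; [apply/xyp|exact: same_out_sym].
move=> c; pose u := F' (sarc_init c); pose w := F' (sarc_tail c).
have : a' u w by apply/FE; rewrite !F'K; apply/sarc_arcP; exists c.
move=> [x [xw ux]]; exists x; apply: sarc_init_tail_inj.
  by rewrite (fE x).1 -((arc_prd _ _).1 ux) contractE F'K.
by rewrite (fE x).2 xw F'K.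
Qed.

(** Level 0 contains a class of two members, and the one that is not the representative, [y], drops
    out of the list. *)
Lemma contract_smaller (r : seq D) : (forall x, h x = 0%R -> x \in r) ->
  exists r' : seq D',
    (forall u, h (val u) = 0%R -> u \in r') /\ (size r' < size r)%N.
Proof.
move=> rE; have [x hx] := good_level_nonempty gD 0%R.
have [y [yr ry _]] := same_out_two gD (rep a x).
have hy : h y = 0%R by rewrite -(same_out_height gD ry) -(same_out_height gD (rep_same a x)).
exists (pmap insub r); split.
  by move=> u hu; rewrite mem_pmap_sub; apply: rE.
rewrite size_pmap_sub -size_filter -[X in (_ < size X)%N](filter_predT r) !size_filter.
rewrite ltn_neqAle count_predT count_size andbT -all_count; apply/allPn; exists y; first exact: rE.
by rewrite -(rep_eq ry) rep_id; apply/eqP => /esym.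
Qed.

End Contract.

Theorem good_digraph_iso (D : choiceType) (a : D -> D -> Prop) (h : D -> int) :
  good_digraph a h -> exists s, dig_iso a (@darc (sarc_digraph Delta2 s)).
Proof.
move=> gD; have /finite_seqP[r rE] := good_fin gD.
have {rE} : forall x, h x = 0%R -> x \in r.
  by move=> x hx; have : [set` r] x by rewrite -rE.
have [n] := ubnP (size r); elim: n => // n IH in D a h gD r *.
move=> rn rE; have [simple|] := pselect (forall x y z, a x y -> a x z -> same_out a y z -> y = z).
  have [r' [r'E r'lt]] := contract_smaller gD rE.
  have [s /(contract_iso gD simple)] :=
    IH _ _ _ (contract_good gD simple) r' (leq_trans r'lt rn) r'E.
  by exists s.+1.
(* One pair of distinct out-neighbours with equal out-neighbourhoods is carried by transitivity to
   every vertex, which is the hypothesis [double]. *)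
move=> nsimple; exists 0%N; apply: (double_iso gD) => x y z xy xz.
apply: contrapT => nyz; apply: nsimple => u v w uv uw vw; apply: contrapT => nvw.
apply: nyz; have [g ag gx] := good_trans gD u x.
have gv : a x (g v) by rewrite -gx; exact: (ag.2 _ _).1.
have gw : a x (g w) by rewrite -gx; exact: (ag.2 _ _).1.
have ngvw : g v <> g w by move=> /(dig_aut_inj ag).
have svw : same_out a (g v) (g w) by exact: (dig_aut_same_out _ _ ag).2.
by have [->|->] := good_out_two gD gv gw xy ngvw;
  have [->|->] := good_out_two gD gv gw xz ngvw => //; exact: same_out_sym.
Qed.

(** * Normal subgroups with finite orbits *)

Section OrbitPath.
Variables (T : Type) (R : T -> T -> Prop) (m f : T -> T).
Hypotheses (Rrefl : forall x, R x x) (Rsym : forall x y, R x y -> R y x).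
Hypothesis Rtrans : forall y x z, R x y -> R y z -> R x z.
Hypotheses (Rm : forall x y, R x y -> R (m x) (m y))
           (Rf : forall x y, R x y -> R (f x) (f y)).
Hypotheses (mm : forall x, R (m (m x)) x) (ff : forall x, R (f (f x)) x).
Hypotheses (m_free : forall x, ~ R x (m x)) (f_free : forall x, ~ R x (f x)).
Hypothesis conn : forall P : T -> Prop, (exists x, P x) ->
  (forall x y, R x y -> P x -> P y) -> (forall x, P x -> P (m x)) ->
  (forall x, P x -> P (f x)) -> forall x, P x.
Hypothesis many : forall n (s : nat -> T), exists x, forall i, (i < n)%N -> ~ R (s i) x.

Lemma orbit_coordinates : inhabited T -> exists c : T -> int * bool,
  [/\ forall x y, R x y <-> c x = c y,
      forall x, c (m x) = ((c x).1, ~~ (c x).2) &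
      forall x, c (f x) = (if (c x).2 then ((c x).1 + 1, false)
                           else ((c x).1 - 1, true))%R].
Proof.
move=> [x0].
have fm x : R (f (m (m (f x)))) x by apply: Rtrans (ff x); apply/Rf/mm.
have mf x : R (m (f (f (m x)))) x by apply: Rtrans (mm x); apply/Rm/ff.
have [u [_ uE]] := @two_way_path T (fun x y => R (m (f x)) y)
  (fun x => ex_intro _ _ (Rrefl (m (f x)))) (fun x => ex_intro _ _ (mf x)) x0.
have fu i : R (f (u i)) (m (u (i + 1)%R)).
  by apply: Rtrans (Rm (uE i)); apply: Rsym; exact: mm.
have fmu i : R (f (m (u i))) (u (i - 1)%R).
  have := uE (i - 1)%R; rewrite subrK => ui.
  by apply: Rtrans (fm _); apply/Rf/Rm/Rsym.
have cover x : exists i, R x (u i) \/ R x (m (u i)).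
  move: x; apply: conn; first by exists (u 0%R), 0%R; left.
  - by move=> x y /Rsym yx [i [xi|xi]]; exists i; [left|right]; apply: Rtrans yx xi.
  - move=> x [i [xi|xi]]; exists i; [right|left]; first exact: Rm.
    by apply: Rtrans (mm _); exact: Rm.
  - move=> x [i [xi|xi]].
      by exists (i + 1)%R; right; apply: Rtrans (fu i); exact: Rf.
    by exists (i - 1)%R; left; apply: Rtrans (fmu i); exact: Rf.
(* A coincidence makes the whole path periodic, leaving at most the [n.+1 + n.+1] classes listed by
   [s]. *)
have u_lt i n : R (u i) (u (i + Posz n.+1)%R) -> False.
  move=> ui; have per k : R (u k) (u (k + Posz n.+1)%R).
    suff : R (u (i + (k - i))%R) (u (i + (k - i) + Posz n.+1)%R) by rewrite (addrC i) subrK.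
    elim/int_updown_ind: (k - i)%R => [|j ij|j ij]; first by rewrite addr0.
      have := uE (i + j)%R; have := uE (i + j + Posz n.+1)%R.
      rewrite !addrA (addrAC _ _ 1%R) => e1 /Rsym e2.
      by apply: Rtrans e2 _; apply: Rtrans e1; apply/Rm/Rf.
    rewrite addrA; apply: Rtrans (Rsym (fmu _)) _.
    have -> : (i + j - 1 + Posz n.+1 = i + j + Posz n.+1 - 1)%R by lia.
    by apply: Rtrans (fmu _); apply/Rf/Rm.
  have pern k q : R (u k) (u (k + q * Posz n.+1)%R).
    elim/int_updown_ind: q => [|q IH|q IH]; first by rewrite mul0r addr0.
      by apply: Rtrans IH _; rewrite mulrDl mul1r addrA.
    apply: Rtrans IH _; apply: Rsym; have := per (k + (q - 1) * Posz n.+1)%R.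
    by rewrite -addrA mulrBl mul1r subrK.
  pose s (k : nat) := if (k < n.+1)%N then u (Posz k) else m (u (Posz (k - n.+1))).
  have [x xs] := many (n.+1 + n.+1) s.
  have [k kx] := cover x.
  pose j := `|(k %% Posz n.+1)%Z|%N.
  have jE : Posz j = (k %% Posz n.+1)%Z by rewrite /j; lia.
  have jn : (j < n.+1)%N by lia.
  have uj : R (u (Posz j)) (u k).
    by rewrite (divz_eq k (Posz n.+1)) jE [(_ + (_ %% _)%Z)%R]addrC; exact: pern.
  case: kx => kx.
    apply: (xs j); first by lia.
    by rewrite /s jn; apply: Rtrans uj (Rsym kx).
  apply: (xs (j + n.+1)%N); first by lia.
  rewrite /s ltnNge leq_addl /= addnK; exact: Rtrans (Rm uj) (Rsym kx).
have u_inj i j : R (u i) (u j) -> i = j.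
  move=> uij; have [ltij|ltji|//] := ltgtP i j; exfalso.
    apply: (@u_lt i (absz (j - i - 1)%R)).
    by have -> : (i + Posz ((absz (j - i - 1)%R).+1) = j)%R by lia.
  apply: (@u_lt j (absz (i - j - 1)%R)); apply: Rsym.
  by have -> : (j + Posz ((absz (i - j - 1)%R).+1) = i)%R by lia.
(* Such a coincidence reflects the path onto itself; at the midpoint, according to the parity of
   [i - j], [m] or [f] fixes a class. *)
have um i j : ~ R (u i) (m (u j)).
  move=> uij; have sh k : R (u (i - k)%R) (m (u (j + k)%R)).
    elim/int_updown_ind: k => [|k IH|k IH]; first by rewrite subr0 addr0.
      rewrite opprD !addrA; apply: Rtrans (Rsym (fmu _)) _.
      apply: Rtrans (fu _); apply: Rf.
      by apply: Rtrans (mm _); exact: Rm.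
    have -> : (i - (k - 1) = i - k + 1)%R by lia.
    apply: Rtrans (Rsym (uE _)) _; apply: Rm; rewrite addrA.
    by apply: Rtrans (fmu _); exact: Rf.
  pose k := ((i - j) %/ 2)%Z.
  have := sh k; have [e|e] : (i - k = j + k \/ i - k = j + k + 1)%R by rewrite /k; lia.
    by rewrite e => /m_free.
  rewrite e => uu; apply: (@f_free (u (j + k)%R)).
  have := Rm (Rtrans (uE _) uu) => h.
  apply: Rsym; apply: Rtrans (Rsym (mm _)) _.
  by apply: Rtrans h _; exact: mm.
pose pos (p : int * bool) := if p.2 then u p.1 else m (u p.1).
have pos_inj p q : R (pos p) (pos q) -> p = q.
  case: p q => [i []] [j []]; rewrite /pos /=.
  - by move=> /u_inj ->.
  - by move=> /um.
  - by move=> /Rsym /um.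
  - move=> /Rm h; suff /u_inj -> : R (u i) (u j) by [].
    by apply: Rtrans (Rsym (mm _)) _; apply: Rtrans h _; exact: mm.
have /choice[c cE] : forall x, exists p, R x (pos p).
  by move=> x; have [i [xi|xi]] := cover x; [exists (i, true)|exists (i, false)].
have cP x p : R x (pos p) -> c x = p.
  by move=> xp; apply: pos_inj; apply: Rtrans xp; exact: Rsym.
exists c; split.
- move=> x y; split=> [xy|e]; first by apply: cP; apply: Rtrans xy (cE y).
  by apply: Rtrans (cE x) _; rewrite e; exact: Rsym.
- move=> x; apply: cP; have := cE x; case: (c x) => i [] /= xi; first exact: Rm.
  by apply: Rtrans (mm _); exact: Rm.
- move=> x; apply: cP; have := cE x; case: (c x) => i [] /= /Rf xi.
    exact: Rtrans xi (fu i).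
  exact: Rtrans xi (fmu i).
Qed.

End OrbitPath.

(** By counting: [map phi s] contains all of [s] and has the same length, so it has no
    repetition. *)
Lemma surj_seq_inj (T : eqType) (s : seq T) (phi : T -> T) : uniq s ->
  (forall y, y \in s -> exists2 x, x \in s & phi x = y) ->
  {in s &, injective phi}.
Proof.
move=> us surj.
have sub : {subset s <= map phi s}.
  by move=> y /surj[x xs <-]; exact: map_f.
have um : uniq (map phi s) by apply: leq_size_uniq us sub _; rewrite size_map.
move=> x y xs ys xy; rewrite -(nth_index x xs) -[RHS](nth_index x ys); congr nth.
apply/eqP; rewrite -(nth_uniq (phi x) _ _ um) ?size_map ?index_mem//.
by rewrite !(nth_map x) ?index_mem// !nth_index// xy.
Qed.

(** * Orbits of a normal subgroup in a trivalent graph *)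

Section Trivalent.
Variables (T : choiceType) (E : T -> T -> Prop).
Hypothesis Esym : forall x y, E x y -> E y x.
Hypothesis Econn : forall P : T -> Prop, (exists x, P x) ->
  (forall x y, E x y -> P x -> P y) -> forall y, P y.
Hypothesis Etriv : forall x, exists u v w, [/\ u <> v, u <> w, v <> w &
  forall y, E x y <-> [\/ y = u, y = v | y = w]].
Hypothesis Etrans : forall x y, exists2 g, dig_aut E g & g x = y.
Hypothesis Tinf : infinite_set [set: T].

Variable K : set (T -> T).
Hypothesis K_aut : forall k, K k -> dig_aut E k.
Hypothesis K_id : K id.
Hypothesis K_comp : forall k l, K k -> K l -> K (k \o l).
Hypothesis K_inv : forall k l, K k -> cancel k l -> cancel l k -> K l.
Hypothesis K_norm : forall g g' k,
  dig_aut E g -> cancel g g' -> cancel g' g -> K k -> K (g \o k \o g').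
Hypothesis K_orb_fin : forall x, finite_set [set y | exists2 k, K k & k x = y].
Hypothesis K_stab_inf : forall x, infinite_set [set k | K k /\ k x = x].

Definition orb x y := exists2 k, K k & k x = y.

Lemma orb_refl x : orb x x. Proof. by exists id. Qed.

Lemma orb_sym x y : orb x y -> orb y x.
Proof.
move=> [k Kk <-]; have [[l kl lk] _] := K_aut Kk.
by exists l; [exact: K_inv Kk kl lk|rewrite kl].
Qed.

Lemma orb_trans y x z : orb x y -> orb y z -> orb x z.
Proof. by move=> [k Kk <-] [l Kl <-]; exists (l \o k) => //; exact: K_comp. Qed.

Lemma orb_aut g x y : dig_aut E g -> orb x y -> orb (g x) (g y).
Proof.
move=> ag [k Kk <-]; have [[g' gK g'K] _] := ag.
by exists (g \o k \o g'); [exact: K_norm|rewrite /= gK].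
Qed.

Lemma orb_many n (s : nat -> T) : exists x, forall i, (i < n)%N -> ~ orb (s i) x.
Proof.
apply: contrapT => h; apply: Tinf.
have : finite_set (\bigcup_(i in `I_n) [set y | orb (s i) y]).
  by apply: bigcup_finite => // i _; exact: K_orb_fin.
apply: sub_finite_set => x _; apply: contrapT => nx; apply: h; exists x => i lin o.
by apply: nx; exists i.
Qed.

Lemma orb_two u v : exists x, ~ orb u x /\ ~ orb v x.
Proof.
have [x xE] := orb_many 2 (fun i => if i is 0%N then u else v).
by exists x; split; [exact: (xE 0%N)|exact: (xE 1%N)].
Qed.

Lemma nbr_third v x y : E v x -> E v y -> x <> y -> exists z,
  [/\ z <> x, z <> y, E v z & forall w, E v w -> [\/ w = x, w = y | w = z]].
Proof.
have [a [b [c [ab ac bc vE]]]] := Etriv v.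
have Ea : E v a by apply/vE; constructor 1.
have Eb : E v b by apply/vE; constructor 2.
have Ec : E v c by apply/vE; constructor 3.
by move=> /vE[]-> /vE[]-> // _;
  [exists c|exists b|exists c|exists a|exists b|exists a];
  split=> //; try (by move=> h; [apply: ab|apply: ac|apply: bc]);
  try (by apply: nesym); move=> w /vE[]->;
  by [constructor 1|constructor 2|constructor 3].
Qed.

(** If neighbours always lay in distinct orbits, an element of [K] fixing a vertex would fix its
    neighbours, hence everything, against [K_stab_inf]. *)
Lemma nbrs_orb v : exists x y, [/\ x <> y, E v x, E v y & orb x y].
Proof.
apply: contrapT => h.
have loc u x y : E u x -> E u y -> orb x y -> x = y.
  move=> ux uy xy; apply: contrapT => nxy; apply: h.
  have [g ag gu] := Etrans u v; exists (g x), (g y); split.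
  - by move=> /(dig_aut_inj ag).
  - by rewrite -gu; exact: (ag.2 _ _).1.
  - by rewrite -gu; exact: (ag.2 _ _).1.
  - exact: orb_aut.
apply: (K_stab_inf (x := v)); apply: sub_finite_set (finite_set1 id) => k [Kk kv] /=.
apply/funext; apply: Econn; first by exists v.
move=> x y xy kx; apply: esym; apply: (loc x) => //; last by exists k.
by rewrite -{1}kx; exact: ((K_aut Kk).2 _ _).1.
Qed.

(** If the neighbours of each vertex shared an orbit, connectedness would leave at most two orbits,
    whereas the orbits are finite and [T] is infinite. *)
Lemma nbrs_not_orb v : exists x y, [/\ E v x, E v y & ~ orb x y].
Proof.
apply: contrapT => h.
have loc u x y : E u x -> E u y -> orb x y.
  move=> ux uy; apply: contrapT => nxy; apply: h.
  have [g ag gu] := Etrans u v; have [[g' gK g'K] _] := ag.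
  exists (g x), (g y); split.
  - by rewrite -gu; exact: (ag.2 _ _).1.
  - by rewrite -gu; exact: (ag.2 _ _).1.
  - move=> o; apply: nxy.
    by have := orb_aut (dig_aut_can ag gK g'K) o; rewrite !gK.
have [x [y [_ vx _ _]]] := nbrs_orb v.
have [z [nz1 nz2]] := orb_two v x.
suff [//|//] : orb v z \/ orb x z.
move: z {nz1 nz2}; apply: Econn; first by exists v; left; exact: orb_refl.
have step p q r s : orb p q -> E p r -> E q s -> orb r s.
  move=> [k Kk kp] pr qs; apply: (@orb_trans (k r)); first by exists k.
  by apply: (loc q) => //; rewrite -kp; exact: ((K_aut Kk).2 _ _).1.
move=> p q pq [o|o]; [right|left]; first exact: step o vx pq.
exact: step o (Esym vx) pq.
Qed.

(* Each vertex has a unique neighbour lying alone in its K-orbit among the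
   three neighbours: the matching edge. *)
Lemma matching : exists m f1 f2 : T -> T, forall v,
  [/\ forall w, E v w <-> [\/ w = m v, w = f1 v | w = f2 v],
      f1 v <> f2 v, orb (f1 v) (f2 v) &
      forall w, E v w -> orb w (m v) -> w = m v].
Proof.
suff /choice[p pE] : forall v, exists p : T * T * T,
  [/\ forall w, E v w <-> [\/ w = p.1.1, w = p.1.2 | w = p.2],
      p.1.2 <> p.2, orb p.1.2 p.2 & forall w, E v w -> orb w p.1.1 -> w = p.1.1].
  by exists (fun v => (p v).1.1), (fun v => (p v).1.2), (fun v => (p v).2).
move=> v; have [x [y [xy vx vy oxy]]] := nbrs_orb v.
have [m [mx my vm vE]] := nbr_third vx vy xy.
exists (m, x, y) => /=; split=> //.
  by move=> w; split=> [/vE[]->|[]->] //; by [constructor 1|constructor 2|constructor 3].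
move=> w vw wm; apply: contrapT => nwm.
(* A second neighbour in the orbit of [m] would put all three neighbours in the orbit of [x]. *)
have omx : orb m x.
  have [wE|wE|//] := vE _ vw; rewrite wE in wm.
    exact: orb_sym.
  exact/orb_sym/(orb_trans oxy wm).
have [p [q [vp vq npq]]] := nbrs_not_orb v.
have ox r : E v r -> orb r x.
  by move=> /vE[]->; [exact: orb_refl|exact: orb_sym|].
by apply: npq; apply: orb_trans (ox _ vp) (orb_sym (ox _ vq)).
Qed.

(** * The perfect matching and the two-way path of orbits *)

Section Matching.
Variables m f1 f2 : T -> T.
Hypothesis mE : forall v,
  [/\ forall w, E v w <-> [\/ w = m v, w = f1 v | w = f2 v],
      f1 v <> f2 v, orb (f1 v) (f2 v) &
      forall w, E v w -> orb w (m v) -> w = m v].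

Lemma E_m v : E v (m v). Proof. by have [h _ _ _] := mE v; apply/h; constructor 1. Qed.
Lemma E_f1 v : E v (f1 v). Proof. by have [h _ _ _] := mE v; apply/h; constructor 2. Qed.
Lemma E_f2 v : E v (f2 v). Proof. by have [h _ _ _] := mE v; apply/h; constructor 3. Qed.

Lemma nbr_orb v x y : E v x -> E v y -> x <> m v -> y <> m v -> orb x y.
Proof.
have [vE _ o _] := mE v.
move=> /vE[]-> /vE[]->; rewrite // => _ _; by [exact: orb_refl|exact: orb_sym|].
Qed.

Lemma f1_neq_m v : f1 v <> m v.
Proof.
have [_ ne o h] := mE v; move=> e; apply: ne.
by rewrite e; apply: esym; apply: h; [exact: E_f2|rewrite -e; exact: orb_sym].
Qed.

Lemma f2_neq_m v : f2 v <> m v.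
Proof.
have [_ ne o h] := mE v; move=> e; apply: ne.
by rewrite e; apply: h; [exact: E_f1|rewrite -e].
Qed.

Lemma m_unique v x : E v x -> (forall y, E v y -> orb y x -> y = x) -> x = m v.
Proof.
have [vE ne o _] := mE v.
move=> /vE[]-> // h; case: ne; first by apply: esym; apply: h; [exact: E_f2|exact: orb_sym].
by apply: h => //; exact: E_f1.
Qed.

(** [m_unique] characterises [m v] through [E] and [orb], and every automorphism preserves both,
    [orb] by normality of [K]. *)
Lemma m_aut g v : dig_aut E g -> m (g v) = g (m v).
Proof.
move=> ag; have [[g' gK g'K] gE] := ag; have ag' := dig_aut_can ag gK g'K.
apply: esym; apply: m_unique; first by apply: (gE _ _).1; exact: E_m.
move=> y gvy o; rewrite -[y]g'K; congr g.
have [_ _ _] := mE v; apply; first by rewrite -[v]gK; exact: (ag'.2 _ _).1.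
by rewrite -[m v]gK; exact: orb_aut.
Qed.

Lemma orb_m x y : orb x y -> orb (m x) (m y).
Proof. by move=> [k Kk <-]; rewrite (m_aut _ (K_aut Kk)); exists k. Qed.

(* Otherwise m would be a non-injective surjection between two K-orbits, which
   have the same finite cardinality since K is normal. *)
Lemma mK : involutive m.
Proof.
move=> v; apply: contrapT => mmv.
set u := m v in mmv *.
have uv : E u v by apply: Esym; exact: E_m.
(* As [v] is not [m u], it is one of [f1 u] and [f2 u]; [v2] is the other. *)
have [v2 [v2v uv2 ov]] : exists v2, [/\ v2 <> v, E u v2 & orb v v2].
  have [w1|w1] := pselect (v = f1 u).
    exists (f2 u); split; [by rewrite w1 => /esym; have [] := mE u | exact: E_f2|].
    by apply: (nbr_orb uv (E_f2 u)); [exact: nesym|exact: f2_neq_m].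
  exists (f1 u); split; [exact: nesym|exact: E_f1|].
  by apply: (nbr_orb uv (E_f1 u)); [exact: nesym|exact: f1_neq_m].
have mv2 : m v2 = u.
  have [_ _ _ h] := mE v2; apply: esym; apply: h; first exact: Esym.
  exact: orb_m.
have /finite_seqP[s0 s0E] := K_orb_fin v.
have sE x : (x \in undup s0) = `[< orb v x >].
  rewrite mem_undup; apply/idP/asboolP => h.
    by have : [set` s0] x by []; rewrite -s0E.
  by have : [set` s0] x by rewrite -s0E.
have [g ag gv] := Etrans v u; have [[g' gK g'K] _] := ag.
(* [g'] brings the orbit of [u] back to that of [v], so [g' \o m] covers the orbit of [v] by itself
   while identifying [v] and [v2]. *)
apply: v2v; apply: (surj_seq_inj (s := undup s0) (phi := g' \o m)).
- exact: undup_uniq.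
- move=> y; rewrite sE => /asboolP[k Kk <-].
  have Kl := K_norm ag gK g'K Kk.
  exists ((g \o k \o g') v); first by rewrite sE; apply/asboolP; exists (g \o k \o g').
  rewrite /= -[g (k (g' v))]/((g \o k \o g') v) m_aut; last exact: K_aut.
  by rewrite /= -/u -gv !gK.
- by rewrite sE; apply/asboolP.
- by rewrite sE; apply/asboolP; exact: orb_refl.
- by rewrite /= mv2.
Qed.

Definition adjF x y := E x y /\ y <> m x.

Lemma adjF_sym x y : adjF x y -> adjF y x.
Proof. by move=> [/Esym yx ne]; split=> // e; apply: ne; rewrite e mK. Qed.

Lemma adjF_orb x y z : adjF x y -> adjF x z -> orb y z.
Proof. by move=> [xy ny] [xz nz]; exact: nbr_orb xy xz ny nz. Qed.

Lemma adjF_f1 x : adjF x (f1 x).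
Proof. by split; [exact: E_f1|exact: f1_neq_m]. Qed.

Lemma adjF_f2 x : adjF x (f2 x).
Proof. by split; [exact: E_f2|exact: f2_neq_m]. Qed.

Lemma adjFP x y : adjF x y <-> y = f1 x \/ y = f2 x.
Proof.
split=> [[xy ny]|[]->]; [|exact: adjF_f1|exact: adjF_f2].
by have [xE _ _ _] := mE x; move/xE: xy => []; tauto.
Qed.

Lemma E_adjF x y : E x y <-> y = m x \/ adjF x y.
Proof.
split=> [xy|[->|[]//]]; last exact: E_m.
by have [->|ne] := pselect (y = m x); [left|right].
Qed.

Lemma adjF_aut g x y : dig_aut E g -> adjF x y <-> adjF (g x) (g y).
Proof.
move=> ag; split=> -[xy ne].
  split; first exact: (ag.2 _ _).1.
  by rewrite m_aut// => /(dig_aut_inj ag).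
split; first exact: (ag.2 _ _).2.
by move=> e; apply: ne; rewrite m_aut// e.
Qed.

(** [f1] is an arbitrary choice that may fail to commute with automorphisms, but both non-matching
    neighbours lie in the same orbit. *)
Lemma orb_f1 x y : orb x y -> orb (f1 x) (f1 y).
Proof.
move=> [k Kk <-]; apply: (@orb_trans (k (f1 x))); first by exists k.
by apply: (adjF_orb (x := k x)); [apply/(adjF_aut _ _ (K_aut Kk)).1|]; exact: adjF_f1.
Qed.

Lemma f1f1_orb x : orb (f1 (f1 x)) x.
Proof. by apply: (adjF_orb (x := f1 x)); [|apply: adjF_sym]; exact: adjF_f1. Qed.

(** [m] and [f1] induce involutions on orbits. If one of them fixed an orbit, transitivity and
    normality would make it fix all of them, leaving at most two orbits. *)
Lemma orb_coords : exists c : T -> int * bool,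
  [/\ forall x y, orb x y <-> c x = c y,
      forall x, c (m x) = ((c x).1, ~~ (c x).2) &
      forall x, c (f1 x) = (if (c x).2 then ((c x).1 + 1, false)
                           else ((c x).1 - 1, true))%R].
Proof.
apply: orbit_coordinates.
- exact: orb_refl.
- exact: orb_sym.
- exact: orb_trans.
- exact: orb_m.
- exact: orb_f1.
- by move=> x; rewrite mK; exact: orb_refl.
- exact: f1f1_orb.
- move=> x o.
  have all y : orb y (m y).
    have [g ag <-] := Etrans x y; rewrite m_aut//; exact: orb_aut.
  have [z [nz1 nz2]] := orb_two x (f1 x).
  suff [//|//] : orb x z \/ orb (f1 x) z.
  move: z {nz1 nz2}; apply: Econn; first by exists x; left; exact: orb_refl.
  move=> p q /E_adjF[->|pq] [h|h].
  + by left; apply: orb_trans h (all p).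
  + by right; apply: orb_trans h (all p).
  + by right; apply: orb_trans (orb_f1 h) _; apply: adjF_orb pq; exact: adjF_f1.
  + left; apply: orb_trans (orb_sym (f1f1_orb x)) _.
    by apply: orb_trans (orb_f1 h) _; apply: adjF_orb pq; exact: adjF_f1.
- move=> x o.
  have all y : orb y (f1 y).
    have [g ag <-] := Etrans x y; apply: orb_trans (orb_aut ag o) _.
    by apply: (adjF_orb (x := g x)); [apply: (adjF_aut _ _ ag).1|]; exact: adjF_f1.
  have [z [nz1 nz2]] := orb_two x (m x).
  suff [//|//] : orb x z \/ orb (m x) z.
  move: z {nz1 nz2}; apply: Econn; first by exists x; left; exact: orb_refl.
  move=> p q /E_adjF[->|pq] [h|h].
  + by right; exact: orb_m.
  + by left; rewrite -[x]mK; exact: orb_m.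
  + left; apply: orb_trans h _; apply: orb_trans (all p) _.
    by apply: adjF_orb pq; exact: adjF_f1.
  + right; apply: orb_trans h _; apply: orb_trans (all p) _.
    by apply: adjF_orb pq; exact: adjF_f1.
- move=> P Pi Porb Pm Pf; apply: Econn => // x y /E_adjF[-> /Pm //|xy /Pf Px].
  by apply: Porb Px; apply: adjF_orb xy; exact: adjF_f1.
- exact: orb_many.
- by have [x _] := infinite_setN0 Tinf; constructor.
Qed.

(** * The digraph obtained by contracting the matching *)

Section Levels.
Variable c : T -> int * bool.
Hypothesis c_orb : forall x y, orb x y <-> c x = c y.
Hypothesis c_m : forall x, c (m x) = ((c x).1, ~~ (c x).2).
Hypothesis c_f1 : forall x, c (f1 x) =
  (if (c x).2 then ((c x).1 + 1, false) else ((c x).1 - 1, true))%R.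

Lemma c_adjF x y : adjF x y ->
  c y = (if (c x).2 then ((c x).1 + 1, false) else ((c x).1 - 1, true))%R.
Proof. by move=> xy; rewrite -c_f1; apply/c_orb; apply: adjF_orb xy (adjF_f1 x). Qed.

(** Each matching edge has exactly one end with second coordinate [false]; this end stands for the
    contracted edge. *)
Definition lower := {x : T | ~~ (c x).2}.
Definition to_lower x (cx : ~~ (c x).2) : lower :=
  exist (fun x => ~~ (c x).2) x cx.
Definition lower_arc (x y : lower) := adjF (m (val x)) (val y).
Definition lower_height (x : lower) := (c (val x)).1.

Lemma c_lower (x : lower) : c (val x) = (lower_height x, false).
Proof.
by rewrite /lower_height; move: (svalP x) => /=; case: (c (sval x)) => i [].
Qed.

(** Every edge flips the second coordinate, so agreement propagates along edges. *)
Lemma aut_c2 g x : dig_aut E g -> (c (g x)).2 = (c x).2 ->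
  forall y, (c (g y)).2 = (c y).2.
Proof.
move=> ag gx; apply: Econn; first by exists x.
move=> y z /E_adjF[->|yz] e; first by rewrite -(m_aut y ag) !c_m /= e.
have := (adjF_aut _ _ ag).1 yz => /c_adjF ->.
by rewrite (c_adjF yz) e; case: ifP.
Qed.

(** The default [x] is not reached when [g] preserves the second coordinate. *)
Definition lower_map (g : T -> T) (x : lower) : lower := insubd x (g (val x)).

Lemma val_lower_map g x : (forall y, (c (g y)).2 = (c y).2) ->
  val (lower_map g x) = g (val x).
Proof. by move=> gc; rewrite insubdK// -topredE /= gc; exact: svalP x. Qed.

Lemma lower_map_aut g : dig_aut E g -> (forall y, (c (g y)).2 = (c y).2) ->
  dig_aut lower_arc (lower_map g).
Proof.
move=> ag gc; have [[g' gK g'K] _] := ag.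
have g'c y : (c (g' y)).2 = (c y).2 by rewrite -gc g'K.
split.
  exists (lower_map g') => x; apply: val_inj; first by rewrite !val_lower_map.
  by rewrite !val_lower_map.
move=> x y; rewrite /lower_arc !val_lower_map// (m_aut _ ag); exact: adjF_aut.
Qed.

(** [K] preserves both coordinates, so it acts on [lower] keeping heights; its elements commute with
    [m] and are therefore recovered from that action, which leaves infinitely many. Level 0 lies in
    one [K]-orbit, hence is finite. *)
Lemma lower_good : good_digraph lower_arc lower_height.
Proof.
have up x : ~~ (c x).2 -> (c (m x)).2 by rewrite c_m.
have down x : ~~ (c x).2 -> forall y, adjF (m x) y -> ~~ (c y).2.
  by move=> /up mx y /c_adjF ->; rewrite mx.
split.
- have [x _] := infinite_setN0 Tinf.
  have [cx|cx] := boolP (c x).2; last by constructor; exists x.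
  have cmx : ~~ (c (m x)).2 by rewrite c_m /= cx.
  by constructor; exact: (to_lower cmx).
- by move=> x y /c_adjF; rewrite c_m !c_lower /= => -[].
- move=> x; pose y : lower := to_lower (down _ (svalP x) _ (adjF_f1 _)).
  pose z : lower := to_lower (down _ (svalP x) _ (adjF_f2 _)).
  exists y, z; split; first by have [_ h _ _] := mE (m (sval x)); move=> /(congr1 val).
  move=> w; apply: iff_trans (adjFP _ _) _.
  by split=> -[e|e]; [left|right|left|right]; by [apply: val_inj|rewrite e].
- move=> w.
  have h y : adjF (val w) y -> ~~ (c (m y)).2.
    by move=> /c_adjF e; rewrite c_m e c_lower.
  pose y : lower := to_lower (h _ (adjF_f1 _)).
  pose z : lower := to_lower (h _ (adjF_f2 _)).
  exists y, z; split.
    by move=> /(congr1 val) /= /(inv_inj mK); have [_ ? _ _] := mE (val w).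
  move=> u; rewrite /lower_arc; split.
    move=> /adjF_sym /adjFP[] e; [left|right]; apply: val_inj => /=; by rewrite -e mK.
  by case=> ->; apply: adjF_sym; rewrite /= mK; [exact: adjF_f1|exact: adjF_f2].
- move=> x y; have [g ag gx] := Etrans (val x) (val y).
  have gc : forall y, (c (g y)).2 = (c y).2.
    by apply: (@aut_c2 _ (val x)) => //; rewrite gx !c_lower.
  exists (lower_map g); first exact: lower_map_aut.
  by apply: val_inj; rewrite val_lower_map.
- move=> P [x Px] PE y.
  (* Connectedness of [E] is applied to a statement at [z] about the lower end of the matching edge
     through [z]. *)
  suff h : forall z, forall u : lower, val u = z \/ val u = m z -> P u.
    by apply: (h (val y)); left.
  apply: Econn.
    exists (val x) => u [/val_inj -> //|e].
    by have := c_lower u; rewrite e c_m c_lower.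
  move=> z w /E_adjF[->|zw] h u.
    by rewrite mK => -[] e; apply: h; [right|left].
  have cw := c_adjF zw.
  have [cz|cz] := boolP (c z).2; rewrite ?cz ?(negbTE cz) in cw.
    move=> [e|e]; last by have := c_lower u; rewrite e c_m cw.
    have cmz : ~~ (c (m z)).2 by rewrite c_m /= cz.
    have : P (to_lower cmz : lower) by apply: h; right.
    apply: (PE _ _ _).1; rewrite /lower_arc /= mK e; exact: zw.
  move=> [e|e]; first by have := c_lower u; rewrite e cw.
  have : P (to_lower cz : lower) by apply: h; left.
  by apply: (PE _ _ _).2; rewrite /lower_arc e mK; exact: adjF_sym.
- have [x _] := infinite_setN0 Tinf.
  move=> fin; apply: (K_stab_inf (x := x)).
  have Kc k : K k -> forall y, c (k y) = c y.
    by move=> Kk y; apply: esym; apply/c_orb; exists k.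
  apply: (@finite_set_inj _ _ _ _ lower_map) fin.
    move=> k l; rewrite !inE /= => -[Kk _] [Kl _] kl.
    have low y : ~~ (c y).2 -> k y = l y.
      move=> cy; have := congr1 (fun f => val (f (to_lower cy : lower))) kl.
      by rewrite !val_lower_map //= => z; rewrite Kc.
    apply/funext => y; have [cy|/low //] := boolP (c y).2.
    have : ~~ (c (m y)).2 by rewrite c_m /= cy.
    by move=> /low; rewrite -!m_aut ?mK; do ?exact: K_aut; move=> /(inv_inj mK).
  move=> k [Kk _]; split; first by apply: lower_map_aut; [exact: K_aut|move=> y; rewrite Kc].
  by move=> y; rewrite /lower_height val_lower_map ?Kc// => z; rewrite Kc.
- have [[x0 hx0]|none] := pselect (exists x, lower_height x = 0%R).
    apply: (@finite_set_inj _ _ _ _ val) (K_orb_fin (val x0)).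
      by move=> x y _ _; exact: val_inj.
    move=> x /= hx; apply/c_orb; by rewrite !c_lower hx hx0.
  by apply: sub_finite_set (finite_set0 _) => x /= hx; case: none; exists x.
Qed.

Lemma trivalent_iso s : dig_iso lower_arc (@darc (sarc_digraph Delta2 s)) ->
  exists f : T -> Theta s, bijective f /\ forall x y, E x y <-> adj (f x) (f y).
Proof.
have [d0] := good_inh lower_good.
move=> [F [Fbij FE]]; have [F' FK F'K] := Fbij.
(* [d0] is a mere default: in both branches [insubd] receives a lower vertex. *)
pose f x : Theta s := if (c x).2 then Plus (F (insubd d0 (m x)))
                      else Minus (F (insubd d0 x)).
have fl (u : lower) : f (val u) = Minus (F u).
  by rewrite /f c_lower /= valKd.
have fu (u : lower) : f (m (val u)) = Plus (F u).
  by rewrite /f c_m c_lower /= mK valKd.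
have cover x : exists u : lower, x = val u \/ x = m (val u).
  have [cx|cx] := boolP (c x).2; last by exists (to_lower cx); left.
  have cmx : ~~ (c (m x)).2 by rewrite c_m /= cx.
  by exists (to_lower cmx); right; rewrite /= mK.
have nE (u v : lower) : ~ E (val u) (val v).
  move=> /E_adjF[e|/c_adjF]; last by rewrite !c_lower.
  by have := c_lower v; rewrite e c_m c_lower.
have nE' (u v : lower) : ~ E (m (val u)) (m (val v)).
  move=> /E_adjF[/(inv_inj mK) e|/c_adjF]; last by rewrite !c_m !c_lower.
  by have := c_lower v; rewrite e c_m c_lower.
have lowE (u v : lower) : E (m (val u)) (val v) <-> v = u \/ lower_arc u v.
  apply: iff_trans (E_adjF _ _) _; rewrite mK.
  by split=> -[e|]; by [left; apply: val_inj|left; rewrite e|right].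
exists f; split.
  apply: inj_surj_bijective.
    move=> x y; have [u [->|->]] := cover x; have [v [->|->]] := cover y;
      by rewrite ?fl ?fu // => -[/(can_inj FK) ->].
  move=> [a|a]; first by exists (val (F' a)); rewrite fl F'K.
  by exists (m (val (F' a))); rewrite fu F'K.
move=> x y; have [u [->|->]] := cover x; have [v [->|->]] := cover y;
  rewrite ?fl ?fu /= /underlying_adj /=.
- by split=> [/nE|[]].
- split=> [/Esym/lowE[->|/FE]|]; [by left|by right|].
  move=> [/(can_inj FK) ->|/FE vu]; first exact: E_m.
  by apply: Esym; apply/lowE; right.
- split=> [/lowE[->|/FE]|]; [by right|by left|].
  move=> [/FE uv|/(can_inj FK) ->]; first by apply/lowE; right.
  by apply: Esym; exact: E_m.
- by split=> [/nE'|[]].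
Qed.

End Levels.

End Matching.

Theorem trivalent_Theta : exists s (f : T -> Theta s),
  bijective f /\ forall x y, E x y <-> adj (f x) (f y).
Proof.
have [m [f1 [f2 mE]]] := matching.
have [c [c_orb c_m c_f1]] := orb_coords mE.
have [s isos] := good_digraph_iso (lower_good mE c_orb c_m c_f1).
by exists s; exact: trivalent_iso isos.
Qed.

End Trivalent.

(** * The kernel attached to a finite cut *)

Section Balls.
Variables (T : choiceType) (E : T -> T -> Prop).
Hypothesis Esym : forall x y, E x y -> E y x.
Hypothesis Econn : forall P : T -> Prop, (exists x, P x) ->
  (forall x y, E x y -> P x -> P y) -> forall y, P y.
Hypothesis Efin : forall x, finite_set [set y | E x y].

Fixpoint ball (n : nat) (x : T) : set T :=
  if n is n'.+1 then [set y | ball n' x y \/ exists2 z, ball n' x z & E z y]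
  else [set x].

Lemma ball_finite n x : finite_set (ball n x).
Proof.
elim: n => [|n IH]; first exact: finite_set1.
have := bigcup_finite IH (fun y _ => Efin y).
move=> /(conj IH); rewrite -finite_setU; apply: sub_finite_set.
by move=> y [|[z zn zy]]; [left|right; exists z].
Qed.

Lemma ball_leq n p x : (n <= p)%N -> ball n x `<=` ball p x.
Proof.
by move=> /subnK <-; elim: (p - n)%N => // k IH y /IH; left.
Qed.

Lemma ball_cover x y : exists n, ball n x y.
Proof.
move: y; apply: Econn; first by exists x, 0%N.
by move=> y z yz [n yn]; exists n.+1; right; exists y.
Qed.

Lemma finite_ball x S : finite_set S -> exists n, S `<=` ball n x.
Proof.
move=> /finite_seqP[s ->]; elim: s => [|y s [n IH]]; first by exists 0%N.
have [p yp] := ball_cover x y; exists (n + p)%N => z /=.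
rewrite inE => /orP[/eqP ->|zs]; first exact: ball_leq (leq_addl _ _) _ yp.
exact: ball_leq (leq_addr _ _) _ (IH _ zs).
Qed.

Lemma ball_add n p x y z : ball n x y -> ball p y z -> ball (p + n) x z.
Proof.
move=> xy; elim: p z => [|p IH] z; first by move=> ->.
by move=> [/IH|[w /IH xw wz]]; [left|right; exists w].
Qed.

Lemma ball_stepl n x y z : E x y -> ball n y z -> ball n.+1 x z.
Proof.
move=> xy yz; rewrite -addn1; apply: ball_add yz.
by right; exists x.
Qed.

Lemma ball_sym n x y : ball n x y -> ball n y x.
Proof.
elim: n y => [|n IH] y; first by move=> ->.
move=> [/IH|[z /IH zx zy]]; first by left.
by apply: ball_stepl zx; exact: Esym.
Qed.

Lemma ball_splitl n x z : ball n.+1 x z ->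
  ball n x z \/ exists2 y, E x y & ball n y z.
Proof.
elim: n z => [|n IH] z.
  by move=> [|[y -> yz]]; [left|right; exists z].
case=> [/IH[h|[y xy yz]]|[w /IH[h|[y xy yw]] wz]].
- by left; left.
- by right; exists y => //; left.
- by left; right; exists w.
- by right; exists y => //; right; exists w.
Qed.

Lemma ball_aut g n x y : dig_aut E g -> ball n x y -> ball n (g x) (g y).
Proof.
move=> [_ gE]; elim: n y => [|n IH] y; first by move=> ->.
by move=> [/IH|[z /IH xz zy]]; [left|right; exists (g z) => //; apply: (gE _ _).1].
Qed.

Lemma ball_const (Y : pred T) n x :
  (forall y z, ball n x y -> ball n x z -> E y z -> Y y = Y z) ->
  forall y, ball n x y -> Y y = Y x.
Proof.
elim: n => [|n IH] h y; first by move=> ->.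
have {}IH := IH (fun y z yn zn => h y z (or_introl yn) (or_introl zn)).
move=> [/IH //|[z zn zy]]; rewrite -(IH _ zn); apply/esym/h => //; first by left.
by right; exists z.
Qed.

End Balls.

(** * Integer sums with finite support *)

Section FiniteSums.
Local Open Scope ring_scope.
Variable T : choiceType.
Implicit Types F G : T -> int.

Definition finsupp F := finite_set [set x | F x <> 0].
Definition fsum F : int := \sum_(x \in [set: T]) F x.

Lemma finsuppD F G : finsupp F -> finsupp G -> finsupp (fun x => F x + G x).
Proof.
move=> fF fG; have : finite_set ([set x | F x <> 0] `|` [set x | G x <> 0]).
  by rewrite finite_setU.
apply: sub_finite_set => x /= h; apply: contrapT => /not_orP[/contrapT Fx /contrapT Gx].
by apply: h; rewrite Fx Gx addr0.
Qed.

Lemma finsuppN F : finsupp F -> finsupp (fun x => - F x).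
Proof.
apply: sub_finite_set => x /= h Fx; apply: h.
by rewrite Fx oppr0.
Qed.

Lemma finsupp_comp F g : injective g -> finsupp F -> finsupp (F \o g).
Proof.
by move=> ginj; apply: (finite_set_inj (f := g)) => // x y _ _; exact: ginj.
Qed.

Lemma fsumD F G : finsupp F -> finsupp G ->
  fsum (fun x => F x + G x) = fsum F + fsum G.
Proof.
move=> fF fG; have fU : finite_set ([set x | F x <> 0] `|` [set x | G x <> 0]).
  by rewrite finite_setU.
pose A := fset_set ([set x | F x <> 0] `|` [set x | G x <> 0]).
have FA x : x \notin A -> F x = 0 /\ G x = 0.
  by rewrite in_fset_set// notin_setE => /not_orP[/contrapT ? /contrapT].
rewrite /fsum !(fsbigTE A) ?big_split// => x /FA[] // -> -> //.
Qed.

Lemma fsum0 : fsum (fun=> 0) = 0.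
Proof. exact: fsbig1. Qed.

Lemma fsumN F : finsupp F -> fsum (fun x => - F x) = - fsum F.
Proof.
move=> fF; apply/eqP; rewrite -subr_eq0 opprK -fsumD//; last exact: finsuppN.
by rewrite -fsum0; apply/eqP; congr fsum; apply/funext => x; rewrite addNr.
Qed.

Lemma fsum_comp F g : bijective g -> fsum (F \o g) = fsum F.
Proof. by move=> gb; rewrite /fsum [RHS](reindex_fsbigT g). Qed.

Lemma fsum_eq0 F : finsupp F -> (forall x, 0 <= F x) -> fsum F = 0 ->
  forall x, F x = 0.
Proof.
move=> fF F0 sF x; apply: contrapT => Fx.
pose A := fset_set [set x | F x <> 0].
have FA y : y \notin A -> F y = 0 by rewrite in_fset_set// notin_setE => /contrapT.
move: sF; rewrite /fsum (fsbigTE A)// => /eqP.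
rewrite Num.Theory.psumr_eq0// => /allP /(_ x).
by rewrite in_fset_set// mem_set// => /(_ isT) /eqP.
Qed.

End FiniteSums.

(** * Elliptic automorphisms of a cut with two infinite sides *)

Section Cut.
Local Open Scope ring_scope.
Variables (T : choiceType) (E : T -> T -> Prop).
Hypothesis Esym : forall x y, E x y -> E y x.
Hypothesis Econn : forall P : T -> Prop, (exists x, P x) ->
  (forall x y, E x y -> P x -> P y) -> forall y, P y.
Hypothesis Efin : forall x, finite_set [set y | E x y].
Hypothesis Etrans : forall x y, exists2 g, dig_aut E g & g x = y.
Hypothesis Estab : forall x, infinite_set [set g | dig_aut E g /\ g x = x].

Definition fin_cut (Y : pred T) :=
  exists2 S, finite_set S & forall x y, E x y -> Y x != Y y -> S x.

Variable X : pred T.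
Hypothesis Xcut : fin_cut X.
Hypothesis Xinf : infinite_set [set x | X x].
Hypothesis XCinf : infinite_set [set x | ~~ X x].
Hypothesis Xdich : forall Y : pred T, fin_cut Y ->
  infinite_set [set x | Y x] -> infinite_set [set x | ~~ Y x] ->
  finite_set [set x | Y x != X x] \/ finite_set [set x | Y x != ~~ X x].

Lemma fin_cut_aut g : dig_aut E g -> fin_cut (X \o g).
Proof.
move=> ag; have [S Sfin SE] := Xcut; exists (g @^-1` S).
  apply: (finite_set_inj (f := g)) Sfin => // x y _ _; exact: dig_aut_inj ag _ _.
by move=> x y xy; apply: SE; exact: (ag.2 _ _).1.
Qed.

Lemma infinite_aut g (Y : pred T) : dig_aut E g -> infinite_set [set x | Y x] ->
  infinite_set [set x | Y (g x)].
Proof.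
move=> [[g' gK g'K] _] Yinf fin; apply: Yinf.
apply: (finite_set_inj (f := g')) fin.
  by move=> x y _ _; exact: (can_inj g'K).
by move=> x /= Yx; rewrite g'K.
Qed.

(** The alternatives correspond to [g] fixing or swapping the two ends. *)
Lemma aut_dich g : dig_aut E g ->
  finite_set [set x | X (g x) != X x] \/ finite_set [set x | X (g x) != ~~ X x].
Proof.
move=> ag; apply: Xdich; first exact: fin_cut_aut.
  exact: infinite_aut.
exact: (@infinite_aut g (fun x => ~~ X x)).
Qed.

Definition chi (b : bool) : int := b%:R.
Definition shift g x := chi (X (g x)) - chi (X x).

(* The signed size of g^-1 X compared with X is a homomorphism to the integers
   on the automorphisms fixing the two ends; this is its kernel. *)
Definition elliptic : set (T -> T) :=
  [set g | [/\ dig_aut E g, finsupp (shift g) & fsum (shift g) = 0]].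

Lemma finsupp_chi (Y Z : pred T) : finite_set [set x | Y x != Z x] ->
  finsupp (fun x => chi (Y x) - chi (Z x)).
Proof.
by apply: sub_finite_set => x /=; case: (Y x); case: (Z x).
Qed.

Lemma chiN b : chi (~~ b) = 1 - chi b.
Proof. by case: b. Qed.

Lemma elliptic_id : elliptic id.
Proof.
have e0 : shift id = fun=> 0 by apply/funext => x; rewrite /shift subrr.
split; [by split=> //; exists id| |by rewrite e0 fsum0].
by rewrite e0; apply: sub_finite_set (finite_set0 T) => x /=.
Qed.

(** [shift] is a cocycle, and [fsum] is invariant under composition with a bijection. *)
Lemma elliptic_comp k l : elliptic k -> elliptic l -> elliptic (k \o l).
Proof.
move=> [ak fk sk] [al fl sl].
have e : shift (k \o l) = fun x => (shift k \o l) x + shift l x.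
  by apply/funext => x; rewrite /shift /= subrKA.
have fkl : finsupp (shift k \o l) by apply: finsupp_comp fk; exact: dig_aut_inj al.
split; first exact: dig_aut_comp.
  by rewrite e; exact: finsuppD.
by rewrite e fsumD// fsum_comp ?sk ?sl ?addr0//; case: al.
Qed.

Lemma elliptic_inv k l : elliptic k -> cancel k l -> cancel l k -> elliptic l.
Proof.
move=> [ak fk sk] kl lk.
have e : shift l = fun x => - (shift k \o l) x.
  by apply/funext => x; rewrite /shift /= lk opprB.
have lb : bijective l by exists k.
have fkl : finsupp (shift k \o l) by apply: finsupp_comp fk; exact: bij_inj.
split; last by rewrite e fsumN// fsum_comp// sk oppr0.
  exact: dig_aut_can ak kl lk.
by rewrite e; exact: finsuppN.
Qed.

(** Conjugation alters [shift k] by a term [e \o k - e] of sum zero, and by a sign when [g] swaps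
    the ends. *)
Lemma elliptic_norm g g' k : dig_aut E g -> cancel g g' -> cancel g' g ->
  elliptic k -> elliptic (g \o k \o g').
Proof.
move=> ag gK g'K [ak fk sk].
have ag' := dig_aut_can ag gK g'K.
pose D y := chi (X (g (k y))) - chi (X (g y)).
suff [fD sD] : finsupp D /\ fsum D = 0.
  have e : shift (g \o k \o g') = D \o g'.
    by apply/funext => x; rewrite /shift /D /= g'K.
  split; first by apply: dig_aut_comp => //; exact: dig_aut_comp.
    by rewrite e; apply: finsupp_comp fD; exact: dig_aut_inj ag'.
  by rewrite e fsum_comp//; case: ag'.
have kinj := dig_aut_inj ak; have [kb _] := ak.
have key e (sh : T -> int) : finsupp e -> finsupp sh -> fsum sh = 0 ->
    D = (fun y => sh y + ((e \o k) y + - e y)) -> finsupp D /\ fsum D = 0.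
  move=> fe fs ss ->.
  have fek : finsupp (e \o k) by exact: finsupp_comp.
  have feN := finsuppN fe; have fd := finsuppD fek feN.
  split; first exact: finsuppD.
  by rewrite fsumD// ss add0r fsumD// fsum_comp// fsumN// subrr.
case: (aut_dich ag) => [/finsupp_chi|/(@finsupp_chi (X \o g) (fun x => ~~ X x))] fe.
  apply: (key _ _ fe fk sk); apply/funext => y; rewrite /D /shift /=; lia.
apply: (key _ (fun y => - shift k y) fe (finsuppN fk)); first by rewrite fsumN// sk oppr0.
apply/funext => y; rewrite /D /shift /= !chiN; lia.
Qed.

(** [g] preserves the balls around its fixed point [x]. One of them contains the whole difference,
    and there [shift g] is [F \o g - F] with [F] of finite support. *)
Lemma stab_elliptic g x : dig_aut E g -> g x = x ->
  finite_set [set y | X (g y) != X y] -> elliptic g.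
Proof.
move=> ag gx fin; have fg := finsupp_chi fin; split=> //.
have [n nE] := finite_ball Econn x fin.
have [[g' gK g'K] _] := ag.
have g'x : g' x = x by rewrite -{1}gx gK.
have ag' := dig_aut_can ag gK g'K.
pose b y := `[< ball E n x y >].
have bg y : b (g y) = b y.
  apply/asboolP/asboolP; last by rewrite -{2}gx; exact: ball_aut.
  by move=> /(ball_aut ag'); rewrite gK g'x.
pose F y := chi (b y && X y).
have fF : finsupp F.
  apply: sub_finite_set (ball_finite Efin n x) => y /=; rewrite /F /b.
  by case: asboolP.
have -> : shift g = fun y => (F \o g) y + - F y.
  apply/funext => y; rewrite /shift /F /= bg /b.
  case: asboolP => //= ny; suff -> : X (g y) = X y by rewrite !subrr.
  by apply/eqP; apply: contrapT => /negP /nE.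
rewrite fsumD; first by rewrite fsumN// fsum_comp ?subrr//; case: ag.
  by apply: finsupp_comp fF; exact: dig_aut_inj ag.
exact: finsuppN.
Qed.

(** In the stabilizer, [P] fixes the ends and is elliptic, while [N] swaps them. Composition with
    the inverse of one element of [N] embeds [N] in [P], so finiteness of [P] would bound the whole
    stabilizer. *)
Lemma elliptic_stab_inf x : infinite_set [set k | elliptic k /\ k x = x].
Proof.
move=> fin; apply: (Estab (x := x)).
pose P := [set g | (dig_aut E g /\ g x = x) /\ finite_set [set y | X (g y) != X y]].
pose N := [set g | (dig_aut E g /\ g x = x) /\ ~ finite_set [set y | X (g y) != X y]].
have finP : finite_set P.
  apply: sub_finite_set fin => g [[ag gx] fg]; split=> //.
  exact: (stab_elliptic ag gx fg).
suff finN : finite_set N.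
  have : finite_set (P `|` N) by rewrite finite_setU.
  apply: sub_finite_set => g h.
  by have [fg|fg] := pselect (finite_set [set y | X (g y) != X y]); [left|right].
have [[g0 [[ag0 g0x] n0]]|none] := pselect (exists g0, N g0); last first.
  by apply: sub_finite_set (finite_set0 _) => g Ng; case: none; exists g.
have [[h0 g0K h0K] _] := ag0.
have ah0 := dig_aut_can ag0 g0K h0K.
apply: (@finite_set_inj _ _ N P (fun g : T -> T => g \o h0)) finP.
  move=> g1 g2 _ _ /funeqP e; apply/funext => y.
  by have := e (g0 y); rewrite /= g0K.
move=> g [[ag gx] ng]; split.
  split; first exact: dig_aut_comp.
  by rewrite /= -{1}g0x g0K.
have [//|f1] := aut_dich ag; have [//|f0] := aut_dich ag0.
have : finite_set ([set y | X (g y) != ~~ X y] `|` [set y | X (g0 y) != ~~ X y]).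
  by rewrite finite_setU.
apply: (finite_set_inj (f := h0)).
  by move=> y z _ _; exact: (can_inj h0K).
move=> y /=; rewrite h0K; case: (X (g _)); case: (X y); case: (X (h0 y)) => //= _; by [left|right].
Qed.

Lemma closed_pred (Y : pred T) : (forall x y, E x y -> Y x = Y y) ->
  (forall x, Y x) \/ (forall x, ~~ Y x).
Proof.
move=> h; have [[x Yx]|n] := pselect (exists x, Y x).
  left; apply: (Econn (P := fun x => Y x)); first by exists x.
  by move=> y z /h ->.
by right=> x; apply/negP => Yx; apply: n; exists x.
Qed.

Lemma X_not_closed : ~ (forall x y, E x y -> X x = X y).
Proof.
move=> /closed_pred[h|h]; [apply: XCinf|apply: Xinf];
  apply: sub_finite_set (finite_set0 _) => x /=; by rewrite ?h // (negbTE (h x)).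
Qed.

(* If g moves x further than twice the radius of a ball around x containing the
   boundary of X, then X and g X are nested, hence equal as g is elliptic. *)
Lemma elliptic_displacement x : exists n, forall g, elliptic g -> ball E n x (g x).
Proof.
have [S Sfin SE] := Xcut; have [r rE] := finite_ball Econn x Sfin.
exists (r + r)%N => g Kg; have [ag fg sg] := Kg.
apply: contrapT => far.
have [[g' gK g'K] _] := ag.
have ag' := dig_aut_can ag gK g'K.
have [_ fg' sg'] := elliptic_inv Kg gK g'K.
pose Y y := X (g' y).
have XB y z : E y z -> X y != X z -> ball E r x y /\ ball E r x z.
  move=> yz h; split; first exact/rE/(SE _ _ yz h).
  by apply/rE/(SE _ _ (Esym yz)); rewrite eq_sym.
have YB y z : E y z -> Y y != Y z -> ball E r (g x) y /\ ball E r (g x) z.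
  move=> yz h; have [b1 b2] := XB _ _ ((ag'.2 _ _).1 yz) h.
  by split; [rewrite -[y]g'K|rewrite -[z]g'K]; exact: ball_aut.
have disj y : ball E r x y -> ~ ball E r (g x) y.
  by move=> xy /(ball_sym Esym) yg; apply: far; exact: ball_add xy yg.
(* [Y] is the translate of [X] by [g]. The disjoint balls around [x] and [g x] contain the
   boundaries of [X] and [Y] respectively, so each set is constant on the other's ball. *)
have Xc y : ball E r (g x) y -> X y = X (g x).
  apply: ball_const => {}y z yr zr yz; apply/eqP; apply: contrapT => /negP h.
  by have [/disj] := XB _ _ yz h.
have Yc y : ball E r x y -> Y y = Y x.
  apply: ball_const => {}y z yr zr yz; apply/eqP; apply: contrapT => /negP h.
  by have [/(disj _ yr)] := YB _ _ yz h.
set al := X (g x) in Xc; set be := Y x in Yc.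
(* This intersection has no boundary and misses [x], so it is empty: [X] and [Y] are nested, up to
   complements. *)
have empty y : ~~ ((X y != al) && (Y y != be)).
  pose Z y := (X y != al) && (Y y != be).
  have cl : forall y z, E y z -> Z y = Z z.
    rewrite /Z => {}y z yz; have [XX|XX] := eqVneq (X y) (X z).
      have [YY|YY] := eqVneq (Y y) (Y z); first by rewrite XX YY.
      by have [/Xc e1 /Xc e2] := YB _ _ yz YY; rewrite e1 e2 eqxx.
    by have [/Yc e1 /Yc e2] := XB _ _ yz XX; rewrite e1 e2 eqxx !andbF.
  have [h|] := closed_pred cl; last exact.
  by have := h x; rewrite /Z /be eqxx andbF.
have finXY : finite_set [set y | Y y != X y].
  have : finite_set [set y | shift g' y <> 0] := fg'.
  apply: sub_finite_set => z /=; rewrite /shift /Y.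
  by case: (X (g' z)); case: (X z).
(* If [be] were [al], then [Y] would differ from [X] on the whole infinite set where [X] is not
   [al]. *)
have ab : be = ~~ al.
  apply/eqP; rewrite -[_ == _]negbK; apply/negP => h.
  have {}h : be = al by move: h; case: (be); case: (al).
  have : infinite_set [set y | X y != al].
    case: (al).
      by move=> fin; apply: XCinf; apply: sub_finite_set fin => y /=; case: (X y).
    by move=> fin; apply: Xinf; apply: sub_finite_set fin => y /=; case: (X y).
  apply; apply: sub_finite_set finXY => y /= Xy.
  have := empty y; rewrite Xy h /= negbK => /eqP ->; by rewrite eq_sym.
have YX y : Y y = X y.
  (* Nestedness gives [shift g'] a constant sign, and its sum is zero. *)
  have sgn z : 0 <= (if al then - shift g' z else shift g' z).
    have := empty z; rewrite /shift -/(Y z) ab /chi.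
    by case: (al); case: (X z); case: (Y z).
  have : shift g' y = 0.
    move: sgn; case: (al) => sgn; last exact: fsum_eq0.
    apply/eqP; rewrite -oppr_eq0; apply/eqP.
    apply: (fsum_eq0 (F := fun z => - shift g' z)) => //; first exact: finsuppN.
    by rewrite fsumN// sg' oppr0.
  by rewrite /shift /Y; case: (X (g' y)); case: (X y).
(* A boundary edge of [X] lies in the ball around [x], where [Y], now equal to [X], is constant. *)
apply: X_not_closed => y z yz; apply/eqP; apply: contrapT => /negP h.
by have [/Yc e1 /Yc e2] := XB _ _ yz h; move: h; rewrite -!YX e1 e2 eqxx.
Qed.

Lemma elliptic_orb_fin x : finite_set [set y | exists2 k, elliptic k & k x = y].
Proof.
have [n nE] := elliptic_displacement x.
by apply: sub_finite_set (ball_finite Efin n x) => _ [k /nE xk <-].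
Qed.

Lemma cut_Theta :
  (forall x, exists u v w, [/\ u <> v, u <> w, v <> w &
     forall y, E x y <-> [\/ y = u, y = v | y = w]]) ->
  exists s (f : T -> Theta s),
    bijective f /\ forall x y, E x y <-> adj (f x) (f y).
Proof.
move=> Etriv; apply: (@trivalent_Theta T E Esym Econn Etriv Etrans _ elliptic).
- by move=> fin; apply: Xinf; apply: sub_finite_set fin.
- by move=> k [].
- exact: elliptic_id.
- exact: elliptic_comp.
- exact: elliptic_inv.
- exact: elliptic_norm.
- exact: elliptic_orb_fin.
- exact: elliptic_stab_inf.
Qed.

End Cut.

(** * Rays and cuts *)

Section Rays.
Variables (T : choiceType) (E : T -> T -> Prop).
Hypothesis Esym : forall x y, E x y -> E y x.
Hypothesis Econn : forall P : T -> Prop, (exists x, P x) ->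
  (forall x y, E x y -> P x -> P y) -> forall y, P y.
Hypothesis Efin : forall x, finite_set [set y | E x y].

Definition ray (r : nat -> T) := injective r /\ forall n, E (r n) (r n.+1).

Definition ray_eq (r r' : nat -> T) :=
  exists t, [/\ ray t, infinite_set (range t `&` range r) &
                infinite_set (range t `&` range r')].

Lemma ray_leaves (r : nat -> T) (S : set T) : injective r -> finite_set S ->
  exists N, forall n, (N <= n)%N -> ~ S (r n).
Proof.
move=> rinj /finite_seqP[s ->]; elim: s => [|y s [N IH]]; first by exists 0%N.
have [[k rk]|none] := pselect (exists k, r k = y).
  exists (maxn N k.+1) => n; rewrite geq_max => /andP[/IH nS lkn] /=.
  rewrite inE => /orP[/eqP|//]; rewrite -rk => /rinj nk.
  by rewrite nk ltnn in lkn.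
exists N => n /IH nS /=; rewrite inE => /orP[/eqP e|//].
by apply: none; exists n.
Qed.

Lemma ray_meets (t : nat -> T) (A : set T) : infinite_set (range t `&` A) ->
  forall N, exists2 n, (N <= n)%N & A (t n).
Proof.
move=> inf N; apply: contrapT => none; apply: inf.
apply: sub_finite_set (finite_image t (finite_II N)) => _ [[n _ <-] An].
exists n => //=; rewrite ltnNge; apply/negP => Nn; apply: none; by exists n.
Qed.

Lemma ray_cut_const (t : nat -> T) (Y : pred T) : ray t -> fin_cut E Y ->
  exists N, forall n, (N <= n)%N -> Y (t n) = Y (t N).
Proof.
move=> [tinj tE] [S Sfin SE]; have [N NE] := ray_leaves tinj Sfin.
exists N => n /subnK <-; elim: (n - N)%N => // k IH.
rewrite -IH; apply/esym/eqP; apply: contrapT => /negP h.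
exact: (NE (k + N)%N (leq_addl _ _) (SE _ _ (tE _) h)).
Qed.

(** By [ray_cut_const], a ray linking the two would eventually stay on one side of [Y]. *)
Lemma ray_not_eq (r r' : nat -> T) (Y : pred T) : fin_cut E Y ->
  (forall n, Y (r n)) -> (forall n, ~~ Y (r' n)) -> ~ ray_eq r r'.
Proof.
move=> Ycut rY r'Y [t [tray tr tr']]; have [N NE] := ray_cut_const tray Ycut.
have [n nN [k _ kn]] := ray_meets tr N; have [n' n'N [k' _ kn']] := ray_meets tr' N.
have := r'Y k'; rewrite kn' (NE _ n'N) -(NE _ nN) -kn.
by rewrite rY.
Qed.

(* Koenig's lemma along geodesics issuing from a base point. *)
Lemma cut_ray (Y : pred T) : fin_cut E Y -> infinite_set [set x | Y x] ->
  exists2 r, ray r & forall n, Y (r n).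
Proof.
move=> [S Sfin SE] Yinf; have [v _] := infinite_setN0 Yinf.
have /choice[d dE] : forall y, exists n,
    ball E n v y /\ forall k, ball E k v y -> (n <= k)%N.
  move=> y; have ex : exists n, `[< ball E n v y >].
    by have [n h] := ball_cover Econn v y; exists n; apply/asboolP.
  exists (ex_minn ex); case: ex_minnP => n /asboolP h min; split=> // k hk.
  by apply: min; apply/asboolP.
have dle x y k : ball E k x y -> (d y <= k + d x)%N.
  by move=> xy; apply: (dE y).2; exact: ball_add (dE x).1 xy.
have dv : d v = 0%N by apply/eqP; rewrite -leqn0; apply: (dE v).2.
(* [des x] collects the vertices reached from [v] by a geodesic through [x]. *)
pose des x := [set y | exists2 k, ball E k x y & d y = (k + d x)%N].
have step k x y : ball E k.+1 x y -> d y = (k.+1 + d x)%N ->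
    exists z, [/\ E x z, d z = (d x).+1, ball E k z y & d y = (k + d z)%N].
  move=> xy dy; have [/dle|[z xz zy]] := ball_splitl xy.
    by rewrite dy addSn ltnn.
  have dz : (d z <= (d x).+1)%N by rewrite -add1n; apply: dle; right; exists x.
  have dy' := dle _ _ _ zy; exists z.
  by split=> //; lia.
pose good x := infinite_set ([set y | Y y] `&` des x).
have good_next x : good x -> exists z, [/\ E x z, d z = (d x).+1 & good z].
  move=> gx; apply: contrapT => none; apply: gx.
  have : finite_set ([set x] `|` \bigcup_(z in [set z | E x z /\ d z = (d x).+1])
      ([set y | Y y] `&` des z)).
    rewrite finite_setU; split; first exact: finite_set1.
    apply: bigcup_finite; first by apply: sub_finite_set (Efin x) => z [].
    by move=> z [xz dz]; apply: contrapT => gz; apply: none; exists z.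
  apply: sub_finite_set => y [/= Yy [[|k] xy dy]]; first by left.
  have [z [xz dz zy dyz]] := step _ _ _ xy dy.
  by right; exists z => //; split=> //; exists k.
have goodv : good v.
  move=> fin; apply: Yinf; apply: sub_finite_set fin => y Yy; split=> //.
  by exists (d y); [exact: (dE y).1|rewrite dv addn0].
have /choice[nxt nxtE] : forall x, exists z,
    good x -> [/\ E x z, d z = (d x).+1 & good z].
  by move=> x; have [/good_next[z]|ng] := pselect (good x); [exists z|exists x].
pose t n := iter n nxt v.
have tgood n : good (t n) by elim: n => //= n /nxtE[].
have td n : d (t n) = n.
  by elim: n => //= n IH; have [_ -> _] := nxtE _ (tgood n); rewrite IH.
have tE n : E (t n) (t n.+1) by have [] := nxtE _ (tgood n).
have [R RE] := finite_ball Econn v Sfin.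
have out x : S x -> (d x <= R)%N by move=> /RE; exact: (dE x).2.
(* Farther than [R] from [v], a geodesic crosses no boundary edge. *)
have same k x y : (R < d x)%N -> ball E k x y -> d y = (k + d x)%N -> Y x = Y y.
  elim: k x => [|k IH] x Rx; first by move=> ->.
  move=> xy dy; have [z [xz dz zy dyz]] := step _ _ _ xy dy.
  rewrite -(IH z _ zy dyz); last by rewrite dz leqW.
  apply/eqP; apply: contrapT => /negP h.
  by have := out _ (SE _ _ xz h); rewrite leqNgt Rx.
(* The shift by [R.+1] keeps only vertices at distance more than [R], each on the same side as its
   descendants in [Y]. *)
exists (fun n => t (n + R.+1)%N).
  split=> [n n' /(congr1 d)|n]; last exact: tE.
  by rewrite !td => /addIn.
move=> n; have [y [Yy [k xy dy]]] := infinite_setN0 (tgood (n + R.+1)%N).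
by rewrite (same _ _ _ _ xy dy)// td addnS ltnS leq_addl.
Qed.

(** * Equivalence of all rays when every cut has a finite side *)

Section Zigzag.
Hypothesis one_ended : forall Y : pred T, fin_cut E Y ->
  finite_set [set x | Y x] \/ finite_set [set x | ~~ Y x].

Let e : rel T := fun x y => `[< E x y >].

Lemma ray_path r n k : ray r -> exists p,
  [/\ path e (r n) p, last (r n) p = r (n + k)%N &
      forall z, z \in p -> exists2 j, (n < j)%N & z = r j].
Proof.
move=> [_ rE]; elim: k => [|k [p [pp pl pz]]]; first by exists [::]; rewrite addn0.
exists (rcons p (r (n + k.+1)%N)); rewrite rcons_path last_rcons pp pl; split=> //.
  by rewrite addnS; apply/asboolP.
move=> z; rewrite mem_rcons inE => /orP[/eqP ->|/pz //].
by exists (n + k.+1)%N => //; rewrite addnS ltnS leq_addr.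
Qed.

(** The set [C] of vertices reachable from [r1 m] off [s] has finite boundary and contains a tail of
    [r1]. Its complement is therefore finite, and [r2] ends up in [C]. *)
Lemma ray_reach r1 r2 (s : seq T) m : ray r1 -> ray r2 ->
  (forall n, (m <= n)%N -> r1 n \notin s) ->
  exists m2 p, [/\ (m <= m2)%N, path e (r1 m) p, last (r1 m) p = r2 m2 &
    forall z, z \in p -> z \notin s].
Proof.
move=> ray1 ray2 r1s.
pose C y := `[< exists p, [/\ path e (r1 m) p, last (r1 m) p = y &
    forall z, z \in p -> z \notin s] >].
have Cext x y : C x -> E x y -> y \notin s -> C y.
  move=> /asboolP[p [pp <- ps]] xy ys; apply/asboolP; exists (rcons p y).
  rewrite rcons_path pp last_rcons; split=> //; first exact/asboolP.
  by move=> z; rewrite mem_rcons inE => /orP[/eqP ->|/ps].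
have Cr k : C (r1 (m + k)%N).
  elim: k => [|k IH]; first by apply/asboolP; exists [::]; rewrite addn0.
  rewrite addnS; apply: Cext IH _ _; first exact: ray1.2.
  by apply: r1s; rewrite -addnS leq_addr.
have Ccut : fin_cut E C.
  exists ([set` s] `|` \bigcup_(y in [set` s]) [set x | E y x]).
    rewrite finite_setU; split; first exact: finite_seq.
    by apply: bigcup_finite => //; exact: finite_seq.
  move=> x y xy; have [Cx|nCx] := boolP (C x); have [Cy|nCy] := boolP (C y) => // _.
    right; exists y; last exact: Esym.
    by apply: contrapT => /negP ys; move/negP: nCy; apply; exact: Cext Cx xy ys.
  left; apply: contrapT => /negP xs.
  by move/negP: nCx; apply; apply: Cext Cy (Esym xy) xs.
have [Cfin|Cfin] := one_ended Ccut.
  exfalso.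
  apply: (@infinite_set_seq _ [set x | C x] (fun k => r1 (m + k)%N)) Cfin => //.
  by move=> k l h; exact: addnI (ray1.1 _ _ h).
have [N NE] := ray_leaves ray2.1 Cfin.
have : C (r2 (maxn m N)) by apply: contrapT => /negP; exact/NE/leq_maxr.
move=> /asboolP[p [pp pl ps]]; exists (maxn m N), p.
by split=> //; exact: leq_maxl.
Qed.

(** A finite stage of a linking ray; the last condition allows it to be continued along [r] without
    self-intersection. *)
Definition zig r x0 p n := [/\ path e x0 p, uniq (x0 :: p), last x0 p = r n &
  forall m, (n < m)%N -> r m \notin x0 :: p].

(** The path follows [r1] beyond [n], crosses to [r2] by [ray_reach], is shortened to a simple path,
    and is cut at its last vertex index on [r2]. *)
Lemma zig_step r1 r2 x0 p n : ray r1 -> ray r2 -> zig r1 x0 p n ->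
  exists2 q, q <> [::] & exists n', zig r2 x0 (p ++ q) n'.
Proof.
move=> ray1 ray2 [pp pu pl pr].
have [N NE] := ray_leaves ray2.1 (finite_seq (x0 :: p)).
pose m := (n + (N.+1))%N.
have nm : (n < m)%N by rewrite /m addnS ltnS leq_addr.
have [p1 [p1p p1l p1z]] := @ray_path r1 n N.+1 ray1.
have [|m2 [p2 [m2m p2p p2l p2z]]] := @ray_reach r1 r2 (x0 :: p) m ray1 ray2.
  by move=> j mj; apply: pr; exact: leq_trans mj.
have wp : path e (r1 n) (p1 ++ p2) by rewrite cat_path p1p p1l.
have wl : last (r1 n) (p1 ++ p2) = r2 m2 by rewrite last_cat p1l.
have wz z : z \in p1 ++ p2 -> z \notin x0 :: p.
  by rewrite mem_cat => /orP[/p1z[j nj ->]|/p2z //]; exact: pr.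
have r2S k : (m2 <= k)%N -> r2 k \notin x0 :: p.
  by move=> m2k; apply/negP; apply: NE; apply: leq_trans m2k; apply: leq_trans m2m; rewrite /m; lia.
move: wl; case/shortenP: wp => w wp wu wsub wl.
have wS z : z \in w -> z \notin x0 :: p by move=> /wsub; exact: wz.
have m2w : r2 m2 \in w.
  have : r2 m2 \in r1 n :: w by rewrite -wl mem_last.
  rewrite inE => /orP[/eqP r12|//].
  by have := r2S m2 (leqnn _); rewrite r12 -pl mem_last.
(* Taking the largest index [k], rather than the first hit, ensures that [r2] avoids the path after
   [k]. *)
have [k [kw kmax]] : exists k, r2 k \in w /\ forall j, (k < j)%N -> r2 j \notin w.
  have [M ME] := ray_leaves ray2.1 (finite_seq w).
  have bd k : r2 k \in w -> (k <= M)%N.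
    by move=> kw; rewrite leqNgt; apply/negP => /ltnW /ME; apply.
  have ex : exists k, r2 k \in w by exists m2.
  exists (ex_maxn ex bd); case: ex_maxnP => k kw max; split=> // j kj.
  by apply/negP => /max; rewrite leqNgt kj.
have m2k : (m2 <= k)%N.
  by rewrite leqNgt; apply/negP => /kmax; rewrite m2w.
have [w1 [w2 wE]] : exists w1 w2, w = rcons w1 (r2 k) ++ w2.
  by case/path.splitP: kw => w1 w2; exists w1, w2.
have qsub : {subset rcons w1 (r2 k) <= w} by move=> z; rewrite wE mem_cat => ->.
move: wp wu; rewrite wE cat_path /= => /andP[qp _] /andP[_].
rewrite cat_uniq => /andP[qu _].
exists (rcons w1 (r2 k)); first by case: (w1).
exists k; split.
- by rewrite cat_path pp pl.
- rewrite -cat_cons cat_uniq pu qu andbT /=; apply/hasPn => z /qsub /wS.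
  by rewrite !inE.
- by rewrite last_cat last_rcons.
- move=> j kj; rewrite -cat_cons mem_cat negb_or r2S ?(leq_trans m2k (ltnW kj))//=.
  by apply/negP => /qsub; apply/negP/kmax.
Qed.

(** Alternating between [r1] and [r2], [zig_step] builds a growing chain of simple paths whose limit
    is a ray meeting both infinitely often. *)
Lemma one_ended_ray_eq r1 r2 : ray r1 -> ray r2 -> ray_eq r1 r2.
Proof.
move=> ray1 ray2; pose rr (b : bool) := if b then r2 else r1; pose x0 := r1 0%N.
have rrray b : ray (rr b) by case: b.
have /choice[nxt nxtE] : forall bp : bool * seq T, exists q,
    (exists n, zig (rr bp.1) x0 bp.2 n) ->
    q <> [::] /\ exists n, zig (rr (~~ bp.1)) x0 (bp.2 ++ q) n.
  move=> [b p]; have [[n zn]|none] := pselect (exists n, zig (rr b) x0 p n).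
    by have [q q0 qz] := zig_step (rrray b) (rrray (~~ b)) zn; exists q.
  by exists [::] => /none.
pose it k := iter k (fun bp => (~~ bp.1, bp.2 ++ nxt bp)) (false, [::] : seq T).
have itz k : exists n, zig (rr (it k).1) x0 (it k).2 n.
  elim: k => [|k /nxtE[_]//].
  exists 0%N; split=> // m m0; rewrite inE; apply/eqP => h.
  by rewrite (ray1.1 _ _ h) in m0.
have itb k : (it k).1 = odd k by elim: k => //= k ->.
pose p k := (it k).2; pose sz k := size (p k).
have pS k : exists2 q, q <> [::] & p k.+1 = p k ++ q.
  by have [q0 _] := nxtE _ (itz k); exists (nxt (it k)).
have szS k : (sz k < sz k.+1)%N.
  have [q q0 e1] := pS k; rewrite /sz e1 size_cat -addn1 leq_add2l lt0n size_eq0.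
  exact/eqP.
have sz_mono := leq_mono (homo_ltn ltn_trans szS).
have sz_ge k : (k <= sz k)%N by elim: k => // k IH; exact: leq_ltn_trans IH (szS k).
have stable i j n : (i <= j)%N -> (n <= sz i)%N ->
    nth x0 (x0 :: p j) n = nth x0 (x0 :: p i) n.
  move=> /subnK <- nsz; elim: (j - i)%N => // k IH.
  have [q _ e1] := pS (k + i)%N; rewrite addSn e1 -cat_cons nth_cat /= ltnS.
  by rewrite (leq_trans nsz) // ?IH// -/(sz _) sz_mono leq_addl.
(* Stage [n] is long enough to define entry [n], and later stages do not change it. *)
pose t n := nth x0 (x0 :: p n) n.
have tE j n : (n <= sz j)%N -> t n = nth x0 (x0 :: p j) n.
  move=> nj; rewrite /t; have [lnj|/ltnW ljn] := leqP n j.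
    by rewrite (stable n j).
  exact: stable.
have tray : ray t.
  split=> [n n' tnn'|n].
    have [N [_ u _ _]] := itz (maxn n n').
    have n1 : (n <= sz (maxn n n'))%N by exact: leq_trans (leq_maxl _ _) (sz_ge _).
    have n2 : (n' <= sz (maxn n n'))%N by exact: leq_trans (leq_maxr _ _) (sz_ge _).
    apply/eqP; rewrite -(nth_uniq x0 _ _ u) ?ltnS//.
    by rewrite -!tE// tnn'.
  have [N [/pathP/(_ n) h _ _ _]] := itz n.+1.
  rewrite (tE n.+1 n) ?(ltnW (sz_ge _))// (tE n.+1 n.+1)//=.
  by apply/asboolP; apply: h; exact: sz_ge.
have tsz k : exists n, t (sz k) = rr (odd k) n.
  have [n [_ _ l _]] := itz k; exists n; rewrite -itb -l (last_nth x0).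
  exact: tE.
have meets b : infinite_set (range t `&` range (rr b)).
  (* Even stages end on [r1] and odd ones on [r2]. *)
  apply: (@infinite_set_seq _ _ (fun k => t (sz (b + k.*2)%N))).
    by move=> k l h; apply: double_inj; apply: addnI (incn_inj sz_mono (tray.1 _ _ h)).
  move=> k; split; first by exists (sz (b + k.*2)%N).
  have [n ->] := tsz (b + k.*2)%N; exists n => //.
  by rewrite oddD odd_double addbF; case: b.
by exists t; split=> //; [exact: (meets false)|exact: (meets true)].
Qed.

End Zigzag.

End Rays.

(** * Cuts of a graph with two ends *)

Lemma card_eq_IP (T : Type) (A : set T) n : A #= `I_n -> exists f : T -> nat,
  [/\ forall x, A x -> (f x < n)%N,
      forall x y, A x -> A y -> f x = f y -> x = y &
      forall k, (k < n)%N -> exists2 x, A x & f x = k].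
Proof.
move=> /pcard_eqP/bijPex[f [fA finj fsurj]]; exists f; split.
- by move=> x /fA.
- by move=> x y Ax Ay; apply: finj; rewrite inE.
- by move=> k /fsurj[x Ax <-]; exists x.
Qed.

Section FinCut.
Variables (T : choiceType) (E : T -> T -> Prop).
Implicit Types Y Z : pred T.

Lemma fin_cut_eq Y b : fin_cut E Y -> fin_cut E (fun x => Y x == b).
Proof.
move=> [S Sfin SE]; exists S => // x y xy h; apply: (SE x y) => //.
by apply: contraNneq h => ->.
Qed.

Lemma fin_cutI Y Z : fin_cut E Y -> fin_cut E Z -> fin_cut E (fun x => Y x && Z x).
Proof.
move=> [S Sfin SE] [S' S'fin S'E]; exists (S `|` S'); first by rewrite finite_setU.
move=> x y xy h; have [YY|YY] := eqVneq (Y x) (Y y); last by left; exact: SE YY.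
by right; apply: (S'E x y) => //; apply: contraNneq h => ->; rewrite YY.
Qed.

End FinCut.

Section TwoEnds.
Variable G : graph.
Let T : choiceType := {classic G}.
Let E : T -> T -> Prop := @adj G.
Hypothesis Econn : forall P : T -> Prop, (exists x, P x) ->
  (forall x y, E x y -> P x -> P y) -> forall y, P y.
Hypothesis Efin : forall x, finite_set [set y | E x y].
Hypothesis two_ends : ends G #= `I_2.

Let Esym : forall x y, E x y -> E y x := @adj_sym G.

Lemma end_of_neq (r r' : nat -> T) : ray E r' -> ~ ray_eq E r r' ->
  end_of (G := G) r <> end_of (G := G) r'.
Proof.
move=> ray' ne e; have : end_of (G := G) r' r'.
  split=> //; exists r'; split=> //; rewrite setIid;
    by apply: (@infinite_set_seq _ _ r'); [exact: ray'.1|move=> n; exists n].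
by rewrite -e => -[_] /ne.
Qed.

(** Each set contains a ray by [cut_ray], and disjointness makes the three rays inequivalent. *)
Lemma not_three_cuts (Y : nat -> pred T) :
  (forall i, fin_cut E (Y i)) -> (forall i, infinite_set [set x | Y i x]) ->
  (forall i j x, (i < j < 3)%N -> Y i x -> ~~ Y j x) -> False.
Proof.
move=> Ycut Yinf Ydisj.
have /choice[r rE] : forall i, exists r : nat -> T, ray E r /\ forall n, Y i (r n).
  by move=> i; have [r] := cut_ray Econn Efin (Ycut i) (Yinf i); exists r.
have [f [f_lt f_inj _]] := card_eq_IP two_ends.
have endr i : ends G (end_of (G := G) (r i)) by exists (r i) => //; exact: (rE i).1.
have ne i j : (i < j < 3)%N -> f (end_of (G := G) (r i)) <> f (end_of (G := G) (r j)).
  move=> ij /(f_inj _ _ (endr i) (endr j)); apply: end_of_neq; first exact: (rE j).1.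
  apply: (ray_not_eq (Ycut i) (rE i).2) => n.
  by apply/negP => /(Ydisj _ _ _ ij); rewrite (rE j).2.
move: (ne 0%N 1%N isT) (ne 0%N 2%N isT) (ne 1%N 2%N isT).
move: (f_lt _ (endr 0%N)) (f_lt _ (endr 1%N)) (f_lt _ (endr 2%N)); lia.
Qed.

(** Without a cut having two infinite sides, all rays would be equivalent. Given two such cuts, at
    most two of the four intersections [A p] of their sides can be infinite. *)
Lemma two_ends_cut : exists X : pred T,
  [/\ fin_cut E X, infinite_set [set x | X x], infinite_set [set x | ~~ X x] &
      forall Y : pred T, fin_cut E Y ->
      infinite_set [set x | Y x] -> infinite_set [set x | ~~ Y x] ->
      finite_set [set x | Y x != X x] \/ finite_set [set x | Y x != ~~ X x]].
Proof.
have [X [Xcut Xinf XCinf]] : exists X : pred T, [/\ fin_cut E X,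
    infinite_set [set x | X x] & infinite_set [set x | ~~ X x]].
  apply: contrapT => none.
  have one (Y : pred T) : fin_cut E Y ->
      finite_set [set x | Y x] \/ finite_set [set x | ~~ Y x].
    by move=> Ycut; apply: contrapT => /not_orP[? ?]; apply: none; exists Y.
  have eqr (r r' : nat -> G) : is_ray r -> is_ray r' -> ray_equiv r r'.
    exact: (one_ended_ray_eq Esym Efin one).
  have [f [_ _ f_surj]] := card_eq_IP two_ends.
  have [_ [r rray <-] f0] := f_surj 0%N isT.
  have [_ [r' rray' <-] f1] := f_surj 1%N isT.
  have e : end_of r = end_of r'.
    by apply/seteqP; split=> t [tray _]; split=> //; exact: eqr.
  by move: f0; rewrite e f1.
exists X; split=> // Y Ycut Yinf YCinf; apply: contrapT => /not_orP[n1 n2].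
pose A (p : bool * bool) x := (X x == p.1) && (Y x == p.2).
have three p q r : p != q -> p != r -> q != r ->
    [\/ finite_set [set x | A p x], finite_set [set x | A q x] | finite_set [set x | A r x]].
  move=> pq pr qr; apply: contrapT => h.
  have dis p1 p2 x : p1 != p2 -> A p1 x -> ~~ A p2 x.
    case: p1 p2 => [a b] [c d]; rewrite /A /= => ne /andP[/eqP -> /eqP ->].
    by apply: contra ne => /andP[/eqP -> /eqP ->].
  (* Every index from 2 on yields the default [r], which completes the family. *)
  apply: (@not_three_cuts (fun i => A (nth r [:: p; q] i))).
  - by move=> i; apply: fin_cutI; exact: fin_cut_eq.
  - move=> [|[|i]] fin; apply: h; [by constructor 1|by constructor 2|constructor 3].
    by move: fin; rewrite nth_default.
  - move=> i j x /andP[+ j3]; case: j j3 => [|[|[|j]]] // _; case: i => [|[|i]] //= _;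
      exact: dis.
have cov (B : pred T) p q : infinite_set [set x | B x] ->
    (forall x, B x -> A p x || A q x) ->
    finite_set [set x | A p x] -> finite_set [set x | A q x] -> False.
  move=> Binf h fp fq; apply: Binf.
  have : finite_set ([set x | A p x] `|` [set x | A q x]) by rewrite finite_setU.
  by apply: sub_finite_set => x /h /orP.
(* All six pairs of intersections are shown not to be both finite, so at most one is finite, against
   [three]. *)
have c1 := cov _ (true, false) (false, true) n1.
have c2 := cov _ (true, true) (false, false) n2.
have c3 := cov _ (true, true) (true, false) Xinf.
have c4 := cov _ (false, true) (false, false) XCinf.
have c5 := cov _ (true, true) (false, true) Yinf.
have c6 := cov _ (true, false) (false, false) YCinf.
have {}c1 := c1 ltac:(by move=> x; rewrite /A /=; case: (X x); case: (Y x)).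
have {}c2 := c2 ltac:(by move=> x; rewrite /A /=; case: (X x); case: (Y x)).
have {}c3 := c3 ltac:(by move=> x; rewrite /A /=; case: (X x); case: (Y x)).
have {}c4 := c4 ltac:(by move=> x; rewrite /A /=; case: (X x); case: (Y x)).
have {}c5 := c5 ltac:(by move=> x; rewrite /A /=; case: (X x); case: (Y x)).
have {}c6 := c6 ltac:(by move=> x; rewrite /A /=; case: (X x); case: (Y x)).
have t1 := three (true, true) (true, false) (false, true) isT isT isT.
have t2 := three (true, true) (true, false) (false, false) isT isT isT.
have t3 := three (true, true) (false, true) (false, false) isT isT isT.
have t4 := three (true, false) (false, true) (false, false) isT isT isT.
case: t1; case: t2; case: t3; case: t4; tauto.
Qed.

End TwoEnds.

Theorem theorem5p3 (G : graph) :
  connected_graph G ->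
  vertex_transitive G ->
  trivalent G ->
  ends G #= `I_2 ->
  (forall x : G, infinite_set (stabilizer x)) ->
  exists s : nat, isomorphic G (Theta s).
Proof.
move=> Gconn Gtrans Gtriv Gends Gstab.
have Econn (P : {classic G} -> Prop) : (exists x, P x) ->
    (forall x y : {classic G}, @adj G x y -> P x -> P y) -> forall y, P y.
  by move=> [x Px] h y; elim: (Gconn x y) Px => //; auto.
have Efin (x : {classic G}) : finite_set [set y : {classic G} | @adj G x y].
  by exists 3%N; exact: Gtriv.
have [X [Xcut Xinf XCinf Xdich]] := two_ends_cut Econn Efin Gends.
have Etriv (x : {classic G}) : exists u v w : {classic G},
    [/\ u <> v, u <> w, v <> w & forall y, @adj G x y <-> [\/ y = u, y = v | y = w]].
  have [f [f_lt f_inj f_surj]] := card_eq_IP (Gtriv x).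
  have [u xu fu] := f_surj 0%N isT; have [v xv fv] := f_surj 1%N isT.
  have [w xw fw] := f_surj 2%N isT; exists u, v, w; split.
  - by move=> uv; move: fu; rewrite uv fv.
  - by move=> uw; move: fu; rewrite uw fw.
  - by move=> vw; move: fv; rewrite vw fw.
  - move=> y; split; last by case=> ->.
    move=> xy; have := f_lt _ xy; case fy : (f y) => [|[|[|k]]] // _.
    + by constructor 1; apply: f_inj; rewrite ?fu.
    + by constructor 2; apply: f_inj; rewrite ?fv.
    + by constructor 3; apply: f_inj; rewrite ?fw.
have [s [f fiso]] := @cut_Theta {classic G} (@adj G) (@adj_sym G) Econn Efin
  Gtrans Gstab X Xcut Xinf XCinf Xdich Etriv.
by exists s, f.
Qed.
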